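(* Let $\Bbbk$ be a field. There exist simplicial complexes $K_1$ and $K_2$ such that (1) $\beta^{-i,2j}(K_1)=\beta^{-i,2j}(K_2)$ for all $i,j$; (2) $\dim K_1=\dim K_2$; (3) $\gamma(K_1)=\gamma(K_2)$; (4) $s(K_1)\neq s(K_2)$ and $s_{\mathbb{R}}(K_1)\neq s_{\mathbb{R}}(K_2)$.
   Context: A simplicial complex $K$ on the vertex set $[m]=\{1,\dots,m\}$ is a collection of subsets of $[m]$ closed under taking subsets and containing $\varnothing$. Let $\Bbbk[m]=\Bbbk[v_1,\dots,v_m]$ be graded by $\deg v_i=2$. The Stanley–Reisner ring is $\Bbbk[K]=\Bbbk[m]/I_{SR}(K)$, where $I_{SR}(K)$ is generated by the monomials $v_{i_1}\cdots v_{i_k}$ with $\{i_1,\dots,i_k\}\notin K$; $\Bbbk$ is a $\Bbbk[m]$-module via $v_i\mapsto 0$. The bigraded Betti numbers are $\beta^{-\ell,2j}(K)=\dim_\Bbbk \mathrm{Tor}^{-\ell,2j}_{\Bbbk[m]}(\Bbbk[K],\Bbbk)$, the dimension of the part of $\mathrm{Tor}_\ell^{\Bbbk[m]}(\Bbbk[K],\Bbbk)$ of internal degree $2j$. The chromatic number $\gamma(K)$ is the least $n$ such that there is a map $f$ from the vertex set to $[n]$ with $f(i)\neq f(j)$ whenever $\{i,j\}\in K$. Let $D^2\subset\mathbb{C}$ be the closed unit disk, $S^1=\partial D^2$, $(D^2,S^1)^I=\{z\in(D^2)^m: |z_j|=1 \text{ for } j\notin I\}$, and $\mathcal{Z}_K=\bigcup_{I\in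 K}(D^2,S^1)^I$ with coordinatewise action of $T^m=(S^1)^m$. Similarly with $D^1=[-1,1]$, $S^0=\{\pm1\}$, ${}_{\mathbb{R}}\mathcal{Z}_K=\bigcup_{I\in K}\{x\in(D^1)^m: x_j\in S^0 \text{ for } j\notin I\}$ with coordinatewise sign-change action of $\mathbb{Z}_2^m$. The Buchstaber invariant $s(K)$ is the maximal rank of toric subgroups $G\subseteq T^m$ acting freely on $\mathcal{Z}_K$; the real Buchstaber invariant $s_{\mathbb{R}}(K)$ is the maximal rank over $\mathbb{Z}_2$ of subgroups $G\subseteq\mathbb{Z}_2^m$ acting freely on ${}_{\mathbb{R}}\mathcal{Z}_K$. *)

(* Defs.v *)
From HB Require Import structures.
From mathcomp Require Import all_boot all_order all_algebra.
From mathcomp Require Import all_classical all_reals all_analysis.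
From mathcomp Require Import complex.
From mathcomp Require Import -(notations) mpoly.

Set Implicit Arguments.
Unset Strict Implicit.
Unset Printing Implicit Defensive.

Import Order.TTheory GRing.Theory Num.Theory.
Import numFieldNormedType.Exports.

Local Open Scope classical_set_scope.
Local Open Scope ring_scope.

(* Ghost vertices (i with [set i] not a face) are allowed. *)
Record simplicial_complex (m : nat) := SimplicialComplex {
  faces : {set {set 'I_m}};
  face0 : finset.set0 \in faces;
  face_sub : forall I J : {set 'I_m}, J \in faces -> I \subset J -> I \in faces
}.

(* The empty complex {set0} has dimension -1. *)
Definition dim_complex (m : nat) (K : simplicial_complex m) : int :=
  (\max_(I in faces K) #|I|)%N%:Z - 1.

(* Without i != j no complex with an actual vertex would be colourable. *)
Definition colorable (m : nat) (K : simplicial_complex m) (n : nat) : bool :=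
  [exists f : {ffun 'I_m -> 'I_n}, forall i, forall j,
     (i != j) && ([set i; j]%SET \in faces K) ==> (f i != f j)].

Lemma ex_colorable (m : nat) (K : simplicial_complex m) :
  exists n, colorable K n.
Proof.
exists m; apply/existsP; exists [ffun i => i].
by apply/forallP => i; apply/forallP => j; rewrite !ffunE; apply/implyP => /andP[].
Qed.

Definition chromatic_number (m : nat) (K : simplicial_complex m) : nat :=
  ex_minn (ex_colorable K).

Section Betti.
Variables (k : fieldType) (m : nat).

Local Notation P := (mpoly.mpoly m k).
Local Notation homogeneous d p := (p \is @mpoly.ishomog1 m k d (@mpoly.mdeg m)).

Definition face_monomial (I : {set 'I_m}) : P :=
  \prod_(i in I) mpoly.mpolyX k (mpoly.mnm1 i).

Definition sr_ideal (K : simplicial_complex m) : set P :=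
  [set p | exists c : {set 'I_m} -> P,
     p = \sum_(I | I \notin faces K) c I * face_monomial I].

(* A resolution   ... -> F_2 -> F_1 -> F_0 -> k[K] -> 0   of k[K] = P / sr_ideal K
   by finitely generated free graded P-modules F_l = P^(res_rank l).
   - Elements of F_l are row vectors, and maps act by multiplication on the right.
   - The i-th basis vector of F_l has degree 2 * res_deg l i.  Since deg v_i = 2,
     a polynomial homogeneous of degree d in the usual sense has degree 2 * d.
   - F_0 -> k[K] maps the i-th basis vector to the class of res_aug i 0 modulo
     sr_ideal K. *)
Record resolution (K : simplicial_complex m) := Resolution {
  res_rank : nat -> nat;
  res_deg : forall l, 'I_(res_rank l) -> nat;
  res_aug : 'cV[P]_(res_rank 0);
  res_diff : forall l, 'M[P]_(res_rank l.+1, res_rank l);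
  res_aug_homog : forall i, homogeneous (res_deg i) (res_aug i 0);
  res_diff_homog : forall l i j, res_diff l i j != 0 ->
    exists2 e, res_deg i = (res_deg j + e)%N & homogeneous e (res_diff l i j);
  res_aug_surj : forall p : P,
    exists u : 'rV[P]_(res_rank 0), sr_ideal K (p - (u *m res_aug) 0 0);
  res_aug_exact : forall u : 'rV[P]_(res_rank 0),
    sr_ideal K ((u *m res_aug) 0 0) <->
    exists w : 'rV[P]_(res_rank 1), u = w *m res_diff 0;
  res_diff_exact : forall l (u : 'rV[P]_(res_rank l.+1)),
    u *m res_diff l = 0 <->
    exists w : 'rV[P]_(res_rank l.+2), u = w *m res_diff l.+1
}.

Section Tor.
Variables (K : simplicial_complex m) (F : resolution K).

(* The differential of F (x)_P k: here P acts on k through v_i |-> 0. *)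
Definition tor_diff (l : nat) : 'M[k]_(res_rank F l.+1, res_rank F l) :=
  map_mx (mpoly.meval (fun=> 0)) (res_diff F l).

Definition tor_cycles (l : nat) : 'M[k]_(res_rank F l) :=
  match l with
  | 0 => 1%:M
  | l'.+1 => kermx (tor_diff l')
  end.

(* Row space: the part of F_l (x)_P k of internal degree 2j. *)
Definition tor_part (l j : nat) : 'M[k]_(res_rank F l) :=
  diag_mx (\row_i (res_deg (r := F) i == j)%:R).

Definition tor_dim (l j : nat) : nat :=
  \rank (tor_cycles l :&: tor_part l j)%MS - \rank (tor_diff l :&: tor_part l j)%MS.

End Tor.

(* beta^{-l,2j}(K).  Such resolutions exist because P is noetherian, and tor_dim
   does not depend on the resolution, so the set below is a singleton. *)
Definition betti (K : simplicial_complex m) (l j : nat) : nat :=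
  xget 0%N [set b | exists F : resolution K, b = tor_dim F l j].

End Betti.

(* The value 0 for sets without a maximum is not used: the ranks below are at
   most m, and the trivial group has rank 0 and acts freely. *)
Definition max_nat (A : set nat) : nat :=
  xget 0%N [set s | A s /\ forall r, A r -> (r <= s)%N].

(* Coordinatewise product: both the group law of a torus and its action. *)
Definition coord_mul (C : pzRingType) (m : nat) (t z : 'rV[C]_m) : 'rV[C]_m :=
  map2_mx *%R t z.

Section Buchstaber.
Variables (R : realType) (m : nat).

Local Notation C := [the numClosedFieldType of R[i]].

Definition torus (n : nat) : set 'rV[C]_n :=
  [set t : 'rV[C]_n | forall i, `|t 0 i| = 1].
Arguments torus : clear implicits.

Definition moment_angle (K : simplicial_complex m) : set 'rV[C]_m :=
  [set z : 'rV[C]_m | exists2 I, I \in faces K &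
     forall j, `|z 0 j| <= 1 /\ (j \notin I -> `|z 0 j| = 1)].

(* G is a subgroup of T^m isomorphic to T^r as a topological group. *)
Definition toric_subgroup (r : nat) (G : set 'rV[C]_m) : Prop :=
  G `<=` torus m /\
  exists (phi : 'rV[C]_r -> 'rV[C]_m) (psi : 'rV[C]_m -> 'rV[C]_r),
    [/\ phi @` torus r = G,
        {in torus r, cancel phi psi},
        {in torus r &, {morph phi : s t / coord_mul s t}},
        {within torus r, continuous phi} &
        {within G, continuous psi}].

Definition acts_freely (K : simplicial_complex m) (G : set 'rV[C]_m) : Prop :=
  forall g z, G g -> moment_angle K z -> coord_mul g z = z -> g = const_mx 1.

Definition buchstaber (K : simplicial_complex m) : nat :=
  max_nat [set r | exists2 G, toric_subgroup r G & acts_freely K G].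

Definition real_moment_angle (K : simplicial_complex m) : set 'rV[R]_m :=
  [set x : 'rV[R]_m | exists2 I, I \in faces K &
     forall j, -1 <= x 0 j <= 1 /\ (j \notin I -> x 0 j = -1 \/ x 0 j = 1)].

Definition sign_act (g : 'rV['F_2]_m) (x : 'rV[R]_m) : 'rV[R]_m :=
  \row_i ((-1) ^+ (g 0 i : nat) * x 0 i).

(* Subgroups of Z_2^m are exactly its F_2-subspaces. *)
Definition real_acts_freely (K : simplicial_complex m)
    (G : {vspace 'rV['F_2]_m}) : Prop :=
  forall g x, g \in G -> real_moment_angle K x -> sign_act g x = x -> g = 0.

Definition real_buchstaber (K : simplicial_complex m) : nat :=
  max_nat [set r | exists2 G : {vspace 'rV['F_2]_m}, r = \dim G & real_acts_freely K G].

End Buchstaber.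

(* Main.v *)
Require Import Defs.
From mathcomp Require Import all_boot all_order all_algebra all_reals.
From mathcomp Require Import all_classical all_analysis.
From mathcomp Require Import perm complex zify.
From mathcomp Require Import -(notations) mpoly.

(** A complex is given by its minimal nonfaces N_i.  A subgroup acts freely iff
    the support of each of its nontrivial elements contains some N_i.  For two
    involutions a and b, no vertex lies in the supports of a, b and ab
    simultaneously, so if any three of the N_i have a common vertex, then both
    Buchstaber invariants are at most 1.  Conversely, three nonfaces without a
    common vertex allow a free subgroup of rank 2.

    If every N_i has a vertex of its own, then the Taylor resolution of the
    Stanley-Reisner ring is minimal, and the Betti numbers only count, for all l
    and j, the l-element families of nonfaces with union of size j.  This leaves
    enough freedom to take four nonfaces of size 5 on ten vertices in two ways
    with the same counts: in [table1] three of them have no common vertex, in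
    [table2] any three have one.  In both complexes all pairs of vertices are
    faces and the smallest vertex set meeting all nonfaces has two elements, so
    the chromatic numbers are 10 and the dimensions are 7. *)

Set Implicit Arguments.
Unset Strict Implicit.
Unset Printing Implicit Defensive.

Import Order.TTheory GRing.Theory Num.Theory.
Import numFieldNormedType.Exports.
Local Open Scope classical_set_scope.
Local Open Scope ring_scope.

(** * Homogeneous matrices *)

(** Chain maps and homotopies are built degree by degree, with types that depend on the degree.
    [Inv] records what a component must satisfy for the next one to exist, [Q] the equation linking
    the two. *)
Lemma dependent_choice_inv (T : nat -> Type) (Inv : forall l, T l -> Prop)
    (Q : forall l, T l -> T l.+1 -> Prop) (t0 : T 0%N) :
  Inv 0%N t0 ->
  (forall l t, Inv l t -> exists t', Inv l.+1 t' /\ Q l t t') ->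
  exists2 f : forall l, T l, f 0%N = t0 & forall l, Q l (f l) (f l.+1).
Proof.
move=> I0 step.
pose next l (x : {t | Inv l t}) : {t | Inv l.+1 t} :=
  let c := cid (step l (sval x) (svalP x)) in
  exist _ (sval c) (proj1 (svalP c)).
pose F := nat_rect (fun l => {t | Inv l t}) (exist _ t0 I0) next.
exists (fun l => sval (F l)) => // l.
exact: (proj2 (svalP (cid (step l (sval (F l)) (svalP (F l)))))).
Qed.

Section Homogeneous.
Variables (k : fieldType) (m : nat).
Local Notation P := (mpoly.mpoly m k).
Local Notation homogeneous d p := (p \is @mpoly.ishomog1 m k d (@mpoly.mdeg m)).
Local Notation pihomog := (mpoly.pihomog (@mpoly.mdeg m)).

(** By linearity it suffices to treat a monomial in place of [p], whose product with [q] is again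
    homogeneous. *)
Lemma pihomog_mulr (d e : nat) (p q : P) : homogeneous e q ->
  pihomog d (p * q) = if (e <= d)%N then pihomog (d - e) p * q else 0.
Proof.
move=> hq.
have hX (n : mpoly.multinom m) : pihomog d (mpoly.mpolyX k n * q) =
  if (e <= d)%N then pihomog (d - e) (mpoly.mpolyX k n) * q else 0.
  have hn : homogeneous (mpoly.mdeg n + e)%N (mpoly.mpolyX k n * q).
    by apply: mpoly.dhomogM => //; rewrite mpoly.dhomogX.
  rewrite mpoly.pihomogX; case: ifP => led; last first.
    rewrite (mpoly.pihomog_ne0 _ hn) //.
    by apply: contraFneq led => <-; rewrite leq_addl.
  case: eqP => [E|E].
    by rewrite mpoly.pihomog_dE //; move: hn; rewrite E subnK.
  rewrite (mpoly.pihomog_ne0 _ hn) ?mul0r //.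
  by apply: contra_notN E => /eqP <-; rewrite addnK.
have -> : p * q = \sum_(n <- mpoly.msupp p)
    mpoly.mcoeff n p *: (mpoly.mpolyX k n * q).
  rewrite {1}(mpoly.mpolyE p) mulr_suml.
  by apply: eq_bigr => n _; rewrite scalerAl.
have -> : pihomog (d - e) p = \sum_(n <- mpoly.msupp p)
    mpoly.mcoeff n p *: pihomog (d - e) (mpoly.mpolyX k n).
  by rewrite {1}(mpoly.mpolyE p) linear_sum; apply: eq_bigr => n _; rewrite linearZ.
rewrite linear_sum /= mulr_suml; case: ifP => led.
  by apply: eq_bigr => n _; rewrite linearZ /= hX led -scalerAl.
by rewrite big1 // => n _; rewrite linearZ /= hX led scaler0.
Qed.

Definition homogeneous_mx r c (a : 'I_r -> nat) (b : 'I_c -> nat)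
    (A : 'M[P]_(r, c)) : Prop :=
  forall i j, A i j != 0 ->
    exists2 e, a i = (b j + e)%N & homogeneous e (A i j).

(** The degree-preserving part of a map of graded free modules with basis degrees [a] and [b].
    Subtraction of natural numbers truncates, so the entries with [a i < b j] are set to 0
    explicitly. *)
Definition homogeneous_part r c (a : 'I_r -> nat) (b : 'I_c -> nat)
    (A : 'M[P]_(r, c)) : 'M[P]_(r, c) :=
  \matrix_(i, j) if (b j <= a i)%N then pihomog (a i - b j) (A i j) else 0.

Section Parts.
Variables (r c s : nat) (a : 'I_r -> nat) (b : 'I_c -> nat) (d : 'I_s -> nat).

Lemma homogeneous_partP (A : 'M[P]_(r, c)) :
  homogeneous_mx a b (homogeneous_part a b A).
Proof.
move=> i j; rewrite mxE; case: ifP; last by rewrite eqxx.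
move=> le _; exists (a i - b j)%N; first by rewrite subnKC.
exact: mpoly.pihomogP.
Qed.

Lemma homogeneous_part_id (A : 'M[P]_(r, c)) :
  homogeneous_mx a b A -> homogeneous_part a b A = A.
Proof.
move=> hA; apply/matrixP => i j; rewrite mxE.
have [-> | /hA[e -> he]] := eqVneq (A i j) 0; first by rewrite raddf0 if_same.
by rewrite leq_addr addKn mpoly.pihomog_dE.
Qed.

Lemma homogeneous_partD (A B : 'M[P]_(r, c)) :
  homogeneous_part a b (A + B) = homogeneous_part a b A + homogeneous_part a b B.
Proof.
by apply/matrixP => i j; rewrite !mxE; case: ifP; rewrite ?addr0 ?raddfD.
Qed.

Lemma homogeneous_mxB (A B : 'M[P]_(r, c)) :
  homogeneous_mx a b A -> homogeneous_mx a b B -> homogeneous_mx a b (A - B).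
Proof.
move=> hA hB; rewrite -(homogeneous_part_id hA) -(homogeneous_part_id hB).
suff -> : homogeneous_part a b A - homogeneous_part a b B =
  homogeneous_part a b (A - B) by exact: homogeneous_partP.
by apply/matrixP => i j; rewrite !mxE; case: ifP; rewrite ?subr0 ?raddfB.
Qed.

(** This and its mirror image [homogeneous_part_mull] allow chain maps and homotopies to be built
    without regard to degrees and made graded afterwards. *)
Lemma homogeneous_part_mulr (A : 'M[P]_(r, c)) (D : 'M[P]_(c, s)) :
  homogeneous_mx b d D ->
  homogeneous_part a d (A *m D) = homogeneous_part a b A *m D.
Proof.
move=> hD; apply/matrixP => i j; rewrite !mxE raddf_sum.
have -> (x : bool) (G : 'I_c -> P) :
  (if x then \sum_i G i else 0) = \sum_i if x then G i else 0.
  by case: x => //; rewrite big1.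
apply: eq_bigr => n _; rewrite mxE.
have [-> | /hD[e E he]] := eqVneq (D n j) 0; first by rewrite !mulr0 raddf0 if_same.
rewrite /= (pihomog_mulr _ _ he) E subnDA.
case: (leqP (d j) (a i)) => le.
  by rewrite leq_subRL //; case: ifP; rewrite ?mul0r.
by rewrite leqNgt ltn_addr // mul0r.
Qed.

Lemma homogeneous_part_mull (D : 'M[P]_(r, c)) (A : 'M[P]_(c, s)) :
  homogeneous_mx a b D ->
  homogeneous_part a d (D *m A) = D *m homogeneous_part b d A.
Proof.
move=> hD; apply/matrixP => i j; rewrite !mxE raddf_sum.
have -> (x : bool) (G : 'I_c -> P) :
  (if x then \sum_i G i else 0) = \sum_i if x then G i else 0.
  by case: x => //; rewrite big1.
apply: eq_bigr => n _; rewrite mxE.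
have [-> | /hD[e E he]] := eqVneq (D i n) 0; first by rewrite !mul0r raddf0 if_same.
rewrite /= mulrC (pihomog_mulr _ _ he) E.
case: (leqP (d j) (b n)) => le.
  by rewrite (leq_trans le) ?leq_addr // leq_subRL ?(leq_trans le) ?leq_addr //
    leq_add2r le addnC -addnBA // addKn mulrC.
rewrite mulr0; case: (leqP (d j) (b n + e)) => // le'.
by rewrite ifF //; apply/negbTE; rewrite -ltnNge ltn_subLR // ltn_add2r.
Qed.

End Parts.

Lemma homogeneous_mx_mul r c s (a : 'I_r -> nat)
    (b : 'I_c -> nat) (d : 'I_s -> nat) (A : 'M[P]_(r, c)) (D : 'M[P]_(c, s)) :
  homogeneous_mx a b A -> homogeneous_mx b d D -> homogeneous_mx a d (A *m D).
Proof.
move=> hA hD; rewrite -(homogeneous_part_id hA) -(homogeneous_part_mulr _ _ hD).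
exact: homogeneous_partP.
Qed.

Lemma meval0_homogeneous (e : nat) (p : P) :
  homogeneous e p -> mpoly.meval (fun=> 0) p != 0 -> e = 0%N.
Proof.
move=> /mpoly.dhomogP hp; apply: contraNeq => e0.
rewrite mpoly.mevalE big_seq big1 // => n /hp En.
have [i ni] : exists i, n i != 0%N.
  apply/existsP; apply: contraNT e0; rewrite negb_exists => /forallP n0.
  rewrite -En /= mpoly.mdegE big1 // => i _.
  by apply/eqP; move: (n0 i); rewrite negbK.
by rewrite (bigD1 i) //= expr0n (negbTE ni) mul0r mulr0.
Qed.

(** At the origin only entries of degree 0 survive. They join basis vectors of equal degree, so the
    map respects the projections onto internal degree [j]. *)
Lemma homogeneous_mx_eval r c (a : 'I_r -> nat) (b : 'I_c -> nat)
    (A : 'M[P]_(r, c)) (j : nat) :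
  homogeneous_mx a b A ->
  diag_mx (\row_i (a i == j)%:R) *m map_mx (mpoly.meval (fun=> 0)) A =
  map_mx (mpoly.meval (fun=> 0)) A *m diag_mx (\row_i (b i == j)%:R) :> 'M[k]__.
Proof.
move=> hA; rewrite mul_diag_mx mul_mx_diag; apply/matrixP => x y; rewrite !mxE.
have [-> | n0] := eqVneq (mpoly.meval (fun=> 0) (A x y)) 0.
  by rewrite mul0r mulr0.
have [z | nz] := eqVneq (A x y) 0; first by rewrite z raddf0 eqxx in n0.
have [e E he] := hA _ _ nz.
by rewrite E (meval0_homogeneous he n0) addn0 mulrC.
Qed.

End Homogeneous.

Lemma rank_diag_bool (F : fieldType) n (p : pred 'I_n) :
  \rank (diag_mx (\row_i (p i)%:R) : 'M[F]_n) = #|p|.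
Proof.
have -> : \rank (diag_mx (\row_i (p i)%:R) : 'M[F]_n) =
    \rank (\sum_(i | p i) <<delta_mx 0 i : 'rV[F]_n>>)%MS.
  apply/eqmx_rank/andP; split.
    apply/row_subP => i; rewrite row_diag_mx mxE.
    case: (boolP (p i)) => pi; last by rewrite scale0r sub0mx.
    by rewrite scale1r (sumsmx_sup i) // genmxE.
  apply/sumsmx_subP => i pi; rewrite genmxE.
  have -> : delta_mx 0 i = row i (diag_mx (\row_i (p i)%:R)) :> 'rV[F]_n.
    by rewrite row_diag_mx mxE pi scale1r.
  exact: row_sub.
have /mxdirectP -> /= : mxdirect (\sum_(i | p i) <<delta_mx 0 i : 'rV[F]_n>>)%MS.
  by apply: mxdirect_delta => i j _ _.
rewrite (eq_bigr (fun=> 1%N)) ?sum1_card // => i _.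
by rewrite genmxE mxrank_delta.
Qed.

(** * Squarefree monomials and multidegrees *)

Section FaceMonomials.
Variables (k : fieldType) (m : nat).
Local Notation P := (mpoly.mpoly m k).

Definition indicator_mnm (J : {set 'I_m}) : mpoly.multinom m :=
  \big[@mpoly.mnm_add m/@mpoly.mnm0 m]_(i in J) mpoly.mnm1 i.

Lemma indicator_mnmE J x : indicator_mnm J x = (x \in J) :> nat.
Proof.
rewrite /indicator_mnm mpoly.mnm_sumE.
rewrite (eq_bigr (fun i => nat_of_bool (i == x))); last first.
  by move=> i _; rewrite mpoly.mnm1E.
case: (boolP (x \in J)) => xJ.
  rewrite (bigD1 x) //= eqxx big1 // => i /andP[_ /negbTE ->] //.
by rewrite big1 // => i iJ; case: eqP iJ xJ => // -> ->.
Qed.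

Lemma face_monomialX J : face_monomial k J = mpoly.mpolyX k (indicator_mnm J).
Proof.
rewrite /face_monomial /indicator_mnm.
rewrite (big_morph _ (@mpoly.mpolyXD m k) (@mpoly.mpolyX0 m k)) //.
Qed.

Lemma face_monomial0 : face_monomial k (finset.set0 : {set 'I_m}) = 1.
Proof. by rewrite /face_monomial big_set0. Qed.

Lemma face_monomial_neq0 J : face_monomial k J != 0 :> P.
Proof.
rewrite face_monomialX; apply/eqP => /(congr1 (mpoly.mcoeff (indicator_mnm J))).
by rewrite mpoly.mcoeffX eqxx mpoly.mcoeff0; apply/eqP/oner_neq0.
Qed.

Lemma face_monomial_homogeneous J :
  face_monomial k J \is @mpoly.ishomog1 m k #|J| (@mpoly.mdeg m).
Proof.
rewrite face_monomialX mpoly.dhomogX /= mpoly.mdegE; apply/eqP.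
rewrite (eq_bigr (fun x => nat_of_bool (x \in J))) ?sum1_card -?big_mkcond ?sum1_card //.
by move=> x _; rewrite indicator_mnmE.
Qed.

Lemma face_monomialD (I J : {set 'I_m}) : I \subset J ->
  face_monomial k J = face_monomial k (J :\: I)%SET * face_monomial k I.
Proof.
move=> IJ; rewrite /face_monomial mulrC [LHS](big_setID I) /=.
by rewrite (finset.setIidPr IJ).
Qed.

Definition mnm_supp (b : mpoly.multinom m) : {set 'I_m} := [set x | b x != 0%N]%SET.

Lemma mcoeff_mul_face_monomial (q : P) (J : {set 'I_m}) b :
  mpoly.mcoeff b (q * face_monomial k J) != 0 -> J \subset mnm_supp b.
Proof.
rewrite face_monomialX [q]mpoly.mpolyE mulr_suml raddf_sum /= => nz.
apply: contraNT nz => /fintype.subsetPn[x xJ]; rewrite inE negbK => /eqP bx.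
rewrite big1 // => e _.
rewrite -scalerAl mpoly.mcoeffZ -mpoly.mpolyXD mpoly.mcoeffX.
case: eqP => [E|]; last by rewrite mulr0.
by move: bx; rewrite -E mpoly.mnmDE indicator_mnmE xJ addn1.
Qed.

(** Each monomial of [p] is divided separately. Together with [mcoeff_mul_face_monomial] this makes
    divisibility by a squarefree monomial a condition on each multidegree. *)
Lemma face_monomial_factor (p : P) (J : {set 'I_m}) :
  (forall b, mpoly.mcoeff b p != 0 -> J \subset mnm_supp b) ->
  exists q, p = q * face_monomial k J.
Proof.
move=> hp; exists (\sum_(b <- mpoly.msupp p) mpoly.mcoeff b p *:
  mpoly.mpolyX k (mpoly.mnm_sub b (indicator_mnm J))).
rewrite mulr_suml {1}(mpoly.mpolyE p) big_seq [RHS]big_seq.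
apply: eq_bigr => b; rewrite mpoly.mcoeff_msupp => /hp/fintype.subsetP bJ.
rewrite -scalerAl face_monomialX -mpoly.mpolyXD mpoly.submK //.
apply/mpoly.mnm_lepP => x; rewrite indicator_mnmE.
by case: (boolP (x \in J)) => // /bJ; rewrite inE lt0n.
Qed.

(** The part of [p] in the multidegrees selected by [Q]; it lets a construction depend on the
    multidegree. *)
Definition mpoly_filter (Q : pred (mpoly.multinom m)) (p : P) : P :=
  \sum_(b <- mpoly.msupp p | Q b) mpoly.mcoeff b p *: mpoly.mpolyX k b.

Lemma mcoeff_filter Q p b :
  mpoly.mcoeff b (mpoly_filter Q p) = if Q b then mpoly.mcoeff b p else 0.
Proof.
rewrite /mpoly_filter raddf_sum /=.
have [bp | bp] := boolP (b \in mpoly.msupp p); last first.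
  rewrite (mpoly.memN_msupp_eq0 bp) if_same big_seq_cond big1 // => e /andP[ep _].
  rewrite mpoly.mcoeffZ mpoly.mcoeffX; case: eqP => [E|]; last by rewrite mulr0.
  by rewrite E (negbTE bp) in ep.
rewrite big_mkcond (bigD1_seq b) ?mpoly.msupp_uniq //= big1 => [|e ne].
  by rewrite addr0; case: ifP; rewrite // mpoly.mcoeffZ mpoly.mcoeffX eqxx mulr1.
by case: ifP; rewrite // mpoly.mcoeffZ mpoly.mcoeffX (negbTE ne) mulr0.
Qed.
End FaceMonomials.

(** * Comparison of graded free resolutions *)

Section Comparison.
Variables (k : fieldType) (m : nat) (K : simplicial_complex m).
Local Notation P := (mpoly.mpoly m k).

Lemma sr_ideal0 : @sr_ideal k m K 0.
Proof. by exists (fun=> 0); rewrite big1 // => I _; rewrite mul0r. Qed.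

Lemma sr_idealD (p q : P) : sr_ideal K p -> sr_ideal K q -> sr_ideal K (p + q).
Proof.
move=> [c ->] [d ->]; exists (fun I => c I + d I).
by rewrite -big_split; apply: eq_bigr => I _; rewrite mulrDl.
Qed.

Lemma sr_idealM (p q : P) : sr_ideal K q -> sr_ideal K (p * q).
Proof.
move=> [c ->]; exists (fun I => p * c I).
by rewrite mulr_sumr; apply: eq_bigr => I _; rewrite mulrA.
Qed.

Lemma sr_ideal_nonface (I : {set 'I_m}) :
  I \notin faces K -> sr_ideal K (face_monomial k I).
Proof.
move=> nI; exists (fun J => (J == I)%:R).
rewrite (bigD1 I) //= eqxx mul1r big1 ?addr0 // => J /andP[_ /negbTE ->].
by rewrite mul0r.
Qed.

Lemma sr_ideal_mulmx r c (A : 'M[P]_(r, c)) (v : 'cV[P]_c) :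
  (forall i, sr_ideal K (v i 0)) -> forall i, sr_ideal K ((A *m v) i 0).
Proof.
move=> hv i; rewrite mxE.
by elim/big_rec: _ => [|j x _]; [exact: sr_ideal0 | apply/sr_idealD/sr_idealM].
Qed.

Lemma factor_rows r c s (A : 'M[P]_(r, s)) (D : 'M[P]_(c, s)) :
  (forall i, exists w : 'rV[P]_c, row i A = w *m D) -> exists W, A = W *m D.
Proof.
move=> /fin_all_exists[w hw]; exists (\matrix_i w i).
by apply/row_matrixP => i; rewrite hw row_mul rowK.
Qed.

Section OneResolution.
Variable F : resolution k K.

Lemma factor_diff r l (A : 'M[P]_(r, res_rank F l.+1)) :
  A *m res_diff F l = 0 -> exists W, A = W *m res_diff F l.+1.
Proof.
move=> A0; apply: factor_rows => i; apply/res_diff_exact.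
by rewrite -row_mul A0 row0.
Qed.

Lemma factor_aug r (A : 'M[P]_(r, res_rank F 0)) :
  (forall i, sr_ideal K ((A *m res_aug F) i 0)) ->
  exists W, A = W *m res_diff F 0.
Proof.
move=> hA; apply: factor_rows => i; apply/res_aug_exact.
by rewrite -row_mul mxE.
Qed.

Lemma diff_diff l : res_diff F l.+1 *m res_diff F l = 0.
Proof.
apply/row_matrixP => i; rewrite row_mul row0; apply/res_diff_exact.
by exists (delta_mx 0 i); rewrite -rowE.
Qed.

Lemma diff_aug i : sr_ideal K ((res_diff F 0 *m res_aug F) i 0).
Proof.
have := (res_aug_exact (row i (res_diff F 0))).2; rewrite -row_mul mxE; apply.
by exists (delta_mx 0 i); rewrite -rowE.
Qed.

End OneResolution.

Definition chain_map (F G : resolution k K)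
    (f : forall l, 'M[P]_(res_rank F l, res_rank G l)) : Prop :=
  forall l, res_diff F l *m f l = f l.+1 *m res_diff G l.

Definition lifts_id (F G : resolution k K)
    (f : 'M[P]_(res_rank F 0, res_rank G 0)) : Prop :=
  forall i, sr_ideal K ((f *m res_aug G - res_aug F) i 0).

(** Comparison theorem: the images of the basis vectors are lifted, first through the augmentation
    of [G] and then by exactness of [G]. *)
Lemma ex_chain_map (F G : resolution k K) :
  exists2 f : forall l, 'M[P]_(res_rank F l, res_rank G l),
    chain_map f & lifts_id (f 0%N).
Proof.
have [f0 hf0] : exists f0 : 'M[P]_(res_rank F 0, res_rank G 0), lifts_id f0.
  have /fin_all_exists[u hu] i := @res_aug_surj _ _ _ G (res_aug F i 0).
  exists (\matrix_i u i) => i.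
  have -> : (\matrix_i u i *m res_aug G - res_aug F) i 0 =
      (- 1) * (res_aug F i 0 - (u i *m res_aug G) 0 0).
    rewrite mulN1r opprB !mxE; congr (_ - _).
    by apply: eq_bigr => j _; rewrite mxE.
  exact: sr_idealM.
(* In positive degrees the invariant says that [f] preceded by the differential of [F] lands in the
   cycles of [G], so that exactness yields the next component. *)
pose Inv l : 'M[P]_(res_rank F l, res_rank G l) -> Prop :=
  match l with
  | 0 => @lifts_id F G
  | l'.+1 => fun f => res_diff F l'.+1 *m f *m res_diff G l' = 0
  end.
have [|f f0E hf] := @dependent_choice_inv _ Inv
  (fun l f f' => res_diff F l *m f = f' *m res_diff G l) f0 hf0.
  case=> [|l] f /= hf.
    have [i|W hW] := @factor_aug G _ (res_diff F 0 *m f).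
      have -> : (res_diff F 0 *m f *m res_aug G) =
          res_diff F 0 *m (f *m res_aug G - res_aug F) + res_diff F 0 *m res_aug F.
        by rewrite mulmxBr subrK mulmxA.
      rewrite mxE; apply: sr_idealD; last exact: diff_aug.
      exact: sr_ideal_mulmx.
    by exists W; rewrite -mulmxA -hW mulmxA diff_diff mul0mx.
  have [W hW] := factor_diff hf; exists W; split=> //.
  by rewrite -mulmxA -hW mulmxA diff_diff mul0mx.
by exists f => //; rewrite f0E.
Qed.

(** As [e] is a chain map, the invariant d (e - h d) = 0 turns the rows of e - d h in the next
    degree into cycles; exactness then supplies the next [h]. *)
Lemma null_homotopy (F : resolution k K)
    (e : forall l, 'M[P]_(res_rank F l, res_rank F l)) :
  chain_map e -> (forall i, sr_ideal K ((e 0%N *m res_aug F) i 0)) ->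
  exists2 h : forall l, 'M[P]_(res_rank F l, res_rank F l.+1),
    e 0%N = h 0%N *m res_diff F 0 &
    forall l, e l.+1 = res_diff F l *m h l + h l.+1 *m res_diff F l.+1.
Proof.
move=> ce /factor_aug[h0 e0].
have [||h h0E hh] := @dependent_choice_inv
  (fun l => 'M[P]_(res_rank F l, res_rank F l.+1))
  (fun l h => res_diff F l *m (e l - h *m res_diff F l) = 0)
  (fun l h h' => e l.+1 = res_diff F l *m h + h' *m res_diff F l.+1) h0.
- by rewrite e0 subrr mulmx0.
- move=> l h; rewrite mulmxBr ce mulmxA -mulmxBl => /factor_diff[h' hh'].
  exists h'; rewrite -hh' opprB addrC subrK mulmxA diff_diff mul0mx; split=> //.
  by rewrite addrC subrK.
- by exists h; rewrite ?h0E.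
Qed.

Lemma sr_ideal_homogeneous (d : nat) (p : P) :
  sr_ideal K p -> sr_ideal K (mpoly.pihomog (@mpoly.mdeg m) d p).
Proof.
move=> [c ->]; rewrite linear_sum /=.
elim/big_ind: _ => [||I nI]; [exact: sr_ideal0 | exact: sr_idealD |].
rewrite (pihomog_mulr _ _ (face_monomial_homogeneous k I)); case: ifP => _.
  exact/sr_idealM/sr_ideal_nonface.
exact: sr_ideal0.
Qed.

(** The shift [s] of homological degrees is the identity for chain maps and the successor for
    homotopies. *)
Definition homogeneous_family (F G : resolution k K) (s : nat -> nat)
    (f : forall l, 'M[P]_(res_rank F l, res_rank G (s l))) : Prop :=
  forall l, homogeneous_mx (@res_deg _ _ _ F l) (@res_deg _ _ _ G (s l)) (f l).

Lemma ex_homogeneous_chain_map (F G : resolution k K) :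
  exists f : forall l, 'M[P]_(res_rank F l, res_rank G l),
    [/\ chain_map f, lifts_id (f 0%N) & homogeneous_family (s := id) f].
Proof.
have [f cf f0] := ex_chain_map F G.
exists (fun l => homogeneous_part (@res_deg _ _ _ F l) (@res_deg _ _ _ G l) (f l)).
split=> [l|i|l]; last exact: homogeneous_partP.
  rewrite -(homogeneous_part_mulr _ _ (@res_diff_homog _ _ _ G l)) -cf.
  by rewrite (homogeneous_part_mull _ _ (@res_diff_homog _ _ _ F l)).
(* The target of the augmentation is P itself, with one basis vector of degree 0. *)
pose z (i : 'I_1) := 0%N.
have hom (H : resolution k K) : homogeneous_mx (@res_deg _ _ _ H 0) z (res_aug H).
  move=> x y _; rewrite ord1 /z; exists (res_deg x) => //.
  exact: res_aug_homog.
rewrite -(homogeneous_part_mulr _ _ (hom G)) -(homogeneous_part_id (hom F)).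
move: (sr_ideal_homogeneous (res_deg i) (f0 i)).
by rewrite !mxE /= !subn0 raddfB.
Qed.

Lemma homogeneous_null_homotopy (F : resolution k K)
    (e : forall l, 'M[P]_(res_rank F l, res_rank F l)) :
  chain_map e -> (forall i, sr_ideal K ((e 0%N *m res_aug F) i 0)) ->
  homogeneous_family (s := id) e ->
  exists h : forall l, 'M[P]_(res_rank F l, res_rank F l.+1),
    [/\ e 0%N = h 0%N *m res_diff F 0,
        forall l, e l.+1 = res_diff F l *m h l + h l.+1 *m res_diff F l.+1 &
        homogeneous_family (s := succn) h].
Proof.
move=> ce ae he; have [h h0 hh] := null_homotopy ce ae.
exists (fun l =>
  homogeneous_part (@res_deg _ _ _ F l) (@res_deg _ _ _ F l.+1) (h l)).
split=> [|l|l]; last exact: homogeneous_partP.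
  rewrite -(homogeneous_part_id (he 0%N)) h0.
  exact: homogeneous_part_mulr (@res_diff_homog _ _ _ F 0).
rewrite -(homogeneous_part_id (he l.+1)) hh homogeneous_partD.
rewrite (homogeneous_part_mulr _ _ (@res_diff_homog _ _ _ F l.+1)).
by rewrite (homogeneous_part_mull _ _ (@res_diff_homog _ _ _ F l)).
Qed.

Lemma homogeneous_homotopy (F G : resolution k K)
    (f : forall l, 'M[P]_(res_rank F l, res_rank G l))
    (g : forall l, 'M[P]_(res_rank G l, res_rank F l)) :
  chain_map f -> lifts_id (f 0%N) -> homogeneous_family (s := id) f ->
  chain_map g -> lifts_id (g 0%N) -> homogeneous_family (s := id) g ->
  exists h : forall l, 'M[P]_(res_rank F l, res_rank F l.+1),
    [/\ f 0%N *m g 0%N - 1%:M = h 0%N *m res_diff F 0,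
        forall l, f l.+1 *m g l.+1 - 1%:M =
          res_diff F l *m h l + h l.+1 *m res_diff F l.+1 &
        homogeneous_family (s := succn) h].
Proof.
move=> cf f0 hf cg g0 hg.
apply: (homogeneous_null_homotopy (e := fun l => f l *m g l - 1%:M)) => [l|i|l].
- by rewrite mulmxBr mulmxBl mulmx1 mul1mx mulmxA cf -mulmxA cg mulmxA.
- rewrite (_ : _ *m _ = f 0%N *m (g 0%N *m res_aug F - res_aug G) +
      (f 0%N *m res_aug G - res_aug F)); last first.
    by rewrite mulmxBl mul1mx mulmxBr addrA subrK mulmxA.
  by rewrite mxE; apply: sr_idealD (f0 i); apply: sr_ideal_mulmx.
- apply: homogeneous_mxB; first exact: (homogeneous_mx_mul (hf l) (hg l)).
  move=> x y; rewrite mxE; have [-> _|_] := eqVneq x y; last by rewrite eqxx.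
  by exists 0%N; rewrite ?addn0 //= mpoly.dhomog1.
Qed.

(** For minimal [T] every element of the tensored complex is a cycle and only 0 is a boundary, so
    Tor has one dimension per basis vector. Graded homotopy equivalences [f] and [g] transfer this
    to an arbitrary resolution [F]. *)
Lemma tor_dim_minimal (F T : resolution k K) (l j : nat) :
  (forall l', tor_diff T l' = 0) ->
  tor_dim F l j = #|[pred i : 'I_(res_rank T l) | res_deg i == j]|.
Proof.
move=> T0.
have [f [cf f0 hf]] := ex_homogeneous_chain_map F T.
have [g [cg g0 hg]] := ex_homogeneous_chain_map T F.
have [h [h0 hS hh]] := homogeneous_homotopy cf f0 hf cg g0 hg.
have [t [t0 tS _]] := homogeneous_homotopy cg g0 hg cf f0 hf.
pose ev r c (A : 'M[P]_(r, c)) : 'M[k]_(r, c) :=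
  map_mx (mpoly.meval (fun=> 0)) A.
have evM r c s (A : 'M[P]_(r, c)) (B : 'M[P]_(c, s)) :
  ev _ _ (A *m B) = ev _ _ A *m ev _ _ B by rewrite /ev map_mxM.
have evB r c (A B : 'M[P]_(r, c)) : ev _ _ (A - B) = ev _ _ A - ev _ _ B.
  by rewrite /ev map_mxB.
have evD r c (A B : 'M[P]_(r, c)) : ev _ _ (A + B) = ev _ _ A + ev _ _ B.
  by rewrite /ev map_mxD.
have ev1 r : ev r r 1%:M = 1%:M by rewrite /ev map_mx1.
have dF l' : ev _ _ (res_diff F l') = tor_diff F l' by [].
have dT l' : ev _ _ (res_diff T l') = 0 by rewrite -(T0 l').
have df l' : tor_diff F l' *m ev _ _ (f l') = 0.
  by rewrite -dF -evM cf evM dT mulmx0.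
have gd l' : ev _ _ (g l'.+1) *m tor_diff F l' = 0.
  by rewrite -dF -evM -cg evM dT mul0mx.
have dd l' : tor_diff F l'.+1 *m tor_diff F l' = 0.
  by rewrite -!dF -evM diff_diff /ev map_mx0.
have gf l' : ev _ _ (g l') *m ev _ _ (f l') = 1%:M.
  apply/eqP; rewrite -subr_eq0 -evM -(ev1 (res_rank T l')) -evB; apply/eqP.
  case: l' => [|l']; first by rewrite t0 evM dT mulmx0.
  by rewrite tS evD !evM !dT mulmx0 mul0mx addr0.
(* The homotopy from the identity to [f] followed by [g] has two terms; the one that starts with the
   differential vanishes on cycles. *)
have fg (z : 'rV[k]_(res_rank F l)) : (z <= tor_cycles F l)%MS ->
    z = z *m ev _ _ (f l) *m ev _ _ (g l) - z *m ev _ _ (h l) *m tor_diff F l.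
  move=> hz; apply/eqP; rewrite eq_sym subr_eq addrC -subr_eq; apply/eqP.
  rewrite -[X in _ - X]mulmx1 -!mulmxA -mulmxBr -evM -ev1 -evB -dF -evM.
  case: {z}l z hz => [|l'] z /=; first by rewrite h0.
  move=> /sub_kermxP zd; rewrite hS evD mulmxDr (evM _ _ _ (res_diff F l')) dF mulmxA zd.
  by rewrite mul0mx add0r.
pose D := tor_part F l j; pose E := tor_part T l j.
have DE : D *m ev _ _ (f l) = ev _ _ (f l) *m E.
  exact: (homogeneous_mx_eval j (hf l)).
have ED : E *m ev _ _ (g l) = ev _ _ (g l) *m D.
  exact: (homogeneous_mx_eval j (hg l)).
have DB (z : 'rV[k]_(res_rank F l)) :
    z *m D = z -> (z *m ev _ _ (h l) *m tor_diff F l <= D)%MS.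
  move=> <-; rewrite -!mulmxA.
  rewrite [D *m (_ *m _)]mulmxA (homogeneous_mx_eval j (hh l)) -!mulmxA.
  rewrite (homogeneous_mx_eval j (@res_diff_homog _ _ _ F l)) !mulmxA.
  exact: submxMl.
have DD : D *m D = D.
  rewrite mulmx_diag; congr diag_mx; apply/rowP => i; rewrite !mxE.
  by case: eqP; rewrite ?mulr1 ?mulr0.
have dZ : (tor_diff F l <= tor_cycles F l)%MS.
  by case: (l) => [|l'] /=; [rewrite submx1 | apply/sub_kermxP; rewrite dd].
have gZ : (ev _ _ (g l) <= tor_cycles F l)%MS.
  by case: (l) => [|l'] /=; [rewrite submx1 | apply/sub_kermxP; rewrite gd].
(* In degree [j] every cycle is a boundary plus an element of the image of [T] under [g]. *)
have dec : (tor_cycles F l :&: D == (tor_diff F l :&: D) + E *m ev _ _ (g l))%MS.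
  apply/andP; split.
    apply/row_subP => i; set z := row i _.
    have /andP[zZ /submxP[y zy]] : (z <= tor_cycles F l)%MS && (z <= D)%MS.
      by rewrite -sub_capmx row_sub.
    have zD : z *m D = z by rewrite zy -mulmxA DD.
    rewrite [z]fg //; apply: addmx_sub; last first.
      rewrite eqmx_opp; apply: submx_trans (addsmxSl _ _).
      by rewrite sub_capmx submxMl DB.
    apply: submx_trans (addsmxSr _ _).
    have -> : z *m ev _ _ (f l) *m ev _ _ (g l) =
        z *m ev _ _ (f l) *m (E *m ev _ _ (g l)).
      by rewrite -{1}zD -!mulmxA [D *m (_ *m _)]mulmxA DE -!mulmxA.
    exact: submxMl.
  rewrite addsmx_sub sub_capmx capmxSr andbT sub_capmx {2}ED submxMl andbT.
  by rewrite (submx_trans (capmxSl _ _) dZ) (submx_trans (submxMl _ _) gZ).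
(* The sum is direct: [f] kills boundaries, whereas [g] followed by [f] is the identity. The ranks
   of the boundaries cancel, and the rank of [E] remains because [g] is injective. *)
rewrite /tor_dim (eqmx_rank dec) mxrank_disjoint_sum; last first.
  apply/eqP; rewrite -submx0; apply/row_subP => i; set z := row i _.
  have : (z <= tor_diff F l)%MS && (z <= E *m ev _ _ (g l))%MS.
    rewrite -sub_capmx; apply: submx_trans (row_sub _ _) _.
    exact: capmxS (capmxSl _ _) _.
  move=> /andP[/submxP[x zx] /submxP[y zy]].
  have : z *m ev _ _ (f l) = 0 by rewrite zx -mulmxA df mulmx0.
  rewrite {1}zy -!mulmxA gf mulmx1 => yE.
  by rewrite zy mulmxA yE mul0mx sub0mx.
rewrite addKn mxrankMfree; last by apply/row_freeP; exists (ev _ _ (f l)).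
exact: rank_diag_bool.
Qed.

End Comparison.

(** * The Taylor resolution *)

Section SimplexBoundary.
Variables (n : nat) (R : pzRingType).

(** The parity of the position of [i] in [i |: S], which gives the sign of the face [S] in the
    boundary of that simplex. *)
Definition sign_add (i : 'I_n) (S : {set 'I_n}) : bool :=
  odd #|[set j in S | (j < i)%N]%SET|.

Lemma sign_addU (i j : 'I_n) (S : {set 'I_n}) : j \notin S ->
  sign_add i (j |: S)%SET = (j < i)%N (+) sign_add i S.
Proof.
move=> jS; rewrite /sign_add; case: ltnP => ji.
  rewrite (_ : [set _ in _ | _]%SET = j |: [set x in S | (x < i)%N])%SET.
    by rewrite cardsU1 !inE (negbTE jS) /=.
  apply/setP => x; rewrite !inE; case: eqP => [->|//].
  by rewrite ji.
rewrite addFb; congr (odd _); apply: eq_card => x; rewrite !inE.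
by case: eqP => [->|//]; rewrite ltnNge ji !andbF.
Qed.

(** The coefficient of [S] in the boundary of the chain with coefficients [c]. All dimensions are
    treated at once, and the empty face makes the complex augmented. *)
Definition simplex_boundary (c : {set 'I_n} -> R) (S : {set 'I_n}) : R :=
  \sum_(i | i \notin S) (-1) ^+ sign_add i S * c (i |: S)%SET.

(** Adding [i] and [j] in either order leads to the same set, with opposite signs. *)
Lemma simplex_boundaryK c S : simplex_boundary (simplex_boundary c) S = 0.
Proof.
pose t i j := (-1) ^+ sign_add i S * ((-1) ^+ sign_add j (i |: S) *
  c (j |: (i |: S))) : R.
have tN i j : i \notin S -> j \notin S -> (i < j)%N -> t i j + t j i = 0.
  move=> iS jS ij; rewrite /t finset.setUCA !mulrA -!signr_addb !sign_addU // ij.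
  rewrite ltnNge ltnW //= addbN signrN mulNr [sign_add j S (+) _]addbC.
  by rewrite addNr.
have -> : simplex_boundary (simplex_boundary c) S =
    \sum_(i | i \notin S) \sum_(j | (j \notin S) && (i != j)) t i j.
  apply: eq_bigr => i iS; rewrite mulr_sumr; apply: eq_bigl => j.
  by rewrite !inE negb_or andbC eq_sym.
have -> : \sum_(i | i \notin S) \sum_(j | (j \notin S) && (i != j)) t i j =
   \sum_(i | i \notin S) \sum_(j | (j \notin S) && (i < j)%N) t i j +
   \sum_(i | i \notin S) \sum_(j | (j \notin S) && (j < i)%N) t i j.
  rewrite -big_split; apply: eq_bigr => i iS.
  rewrite /= (bigID (fun j : 'I_n => (i < j)%N)) /=; congr (_ + _); apply: eq_bigl => j.
    by rewrite -andbA -(inj_eq val_inj) /=; case: ltngtP; rewrite ?andbF ?andbT.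
  by rewrite -andbA -(inj_eq val_inj) /=; case: ltngtP; rewrite ?andbF ?andbT.
rewrite [X in _ + X](exchange_big_dep (fun j => j \notin S)) /=; last first.
  by move=> i j _ /andP[].
rewrite -big_split /= big1 // => i iS.
rewrite [X in _ + X](eq_bigl (fun j => (j \notin S) && (i < j)%N)); last first.
  by move=> j; rewrite iS.
by rewrite -big_split big1 // => j /andP[jS ij]; apply: tN.
Qed.

(* The cone with apex i0: as i0 is the least element of A, the joins with i0 that
   matter carry the sign +1. *)
Lemma simplex_boundary_cone (c : {set 'I_n} -> R) (A : {set 'I_n}) (i0 : 'I_n) :
  i0 \in A -> (forall j, j \in A -> (i0 <= j)%N) ->
  (forall S, c S != 0 -> S \subset A) -> (forall S, simplex_boundary c S = 0) ->
  forall S, simplex_boundary (fun T => if i0 \in T then c (T :\ i0)%SET else 0) S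
    = c S.
Proof.
move=> i0A i0min cA dc S.
have cD (T : {set 'I_n}) : i0 \notin T -> (-1) ^+ sign_add i0 T * c T = c T.
  move=> i0T; have [-> | /cA TA] := eqVneq (c T) 0; first by rewrite mulr0.
  suff -> : sign_add i0 T = false by rewrite mul1r.
  rewrite /sign_add (_ : [set _ in _ | _]%SET = finset.set0) ?cards0 //.
  apply/setP => j; rewrite !inE; apply/negP => /andP[/(fintype.subsetP TA)/i0min].
  by rewrite leqNgt => /negbTE ->.
(* If [S] lacks the apex, only the join with the apex contributes. *)
rewrite /simplex_boundary; have [i0S | i0S] := boolP (i0 \in S); last first.
  rewrite (bigD1 i0) //= finset.setU11 finset.setU1K // cD //.
  rewrite big1 ?addr0 // => i /andP[_ ne].
  by rewrite finset.in_setU1 eq_sym (negbTE ne) (negbTE i0S) mulr0.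
have i0D : i0 \notin (S :\ i0)%SET by rewrite !inE eqxx.
(* If [S] contains the apex, the cycle condition at [S] without [i0] expresses [c S] by the other
   joins, and moving [i0] past each [i] gives the matching sign. *)
have := dc (S :\ i0)%SET; rewrite /simplex_boundary (bigD1 i0) //= finset.setD1K //.
have -> : (-1) ^+ sign_add i0 (S :\ i0)%SET * c S = c S.
  have [-> | /cA SA] := eqVneq (c S) 0; first by rewrite mulr0.
  suff -> : sign_add i0 (S :\ i0)%SET = false by rewrite mul1r.
  rewrite /sign_add (_ : [set _ in _ | _]%SET = finset.set0) ?cards0 //.
  apply/setP => j; rewrite !inE.
  apply/negP => /andP[/andP[_ /(fintype.subsetP SA)/i0min]].
  by rewrite leqNgt => /negbTE ->.
move/eqP; rewrite addr_eq0 => /eqP ->; rewrite -sumrN.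
apply: eq_big => [i|i iS].
  by rewrite !inE; case: eqP => [->|_]; rewrite ?i0S ?andbF ?andbT.
have ii0 : i != i0 by apply: contraNneq iS => ->.
rewrite finset.in_setU1 i0S orbT.
have -> : ((i |: S) :\ i0 = i |: (S :\ i0))%SET.
  by apply/setP => x; rewrite !inE; case: eqP => [->|//]; rewrite eq_sym (negbTE ii0).
have [-> | /cA iA] := eqVneq (c (i |: (S :\ i0))%SET) 0.
  by rewrite !mulr0 oppr0.
have i0i : (i0 < i)%N.
  rewrite ltn_neqAle eq_sym (inj_eq val_inj) ii0 /=; apply: i0min.
  by apply: (fintype.subsetP iA); rewrite finset.setU11.
by rewrite -{1}(finset.setD1K i0S) sign_addU // i0i /= signrN mulNr.
Qed.
End SimplexBoundary.

(** * The Taylor complex of a family of nonfaces *)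

Section Taylor.
Variables (k : fieldType) (m n : nat) (N : 'I_n -> {set 'I_m}).
Hypothesis N_neq0 : forall i, N i != finset.set0.
Local Notation P := (mpoly.mpoly m k).

Definition faces_avoiding : {set {set 'I_m}} :=
  [set I : {set 'I_m} | [forall i, ~~ (N i \subset I)]]%SET.

Lemma faces_avoiding0 : finset.set0 \in faces_avoiding.
Proof. by rewrite inE; apply/forallP => i; rewrite finset.subset0. Qed.

Lemma faces_avoiding_sub (I J : {set 'I_m}) :
  J \in faces_avoiding -> I \subset J -> I \in faces_avoiding.
Proof.
rewrite !inE => /forallP hJ IJ; apply/forallP => i.
by apply: contra (hJ i) => /fintype.subset_trans; apply.
Qed.

Definition complex_of_nonfaces : simplicial_complex m :=
  SimplicialComplex faces_avoiding0 faces_avoiding_sub.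

Lemma nonfaceP (I : {set 'I_m}) :
  reflect (exists i, N i \subset I) (I \notin faces complex_of_nonfaces).
Proof.
rewrite /= inE negb_forall; apply: (iffP existsP) => -[i hi]; exists i => //.
  by rewrite negbK in hi.
by rewrite negbK.
Qed.

Local Notation K := complex_of_nonfaces.

Definition union_nonfaces (S : {set 'I_n}) : {set 'I_m} :=
  (\bigcup_(i in S) N i)%SET.
Local Notation U := union_nonfaces.

Lemma union_nonfacesS (S T : {set 'I_n}) : S \subset T -> U S \subset U T.
Proof.
move=> /fintype.subsetP ST; apply/finset.bigcupsP => i iS.
by apply: finset.bigcup_sup; apply: ST.
Qed.

(** In homological degree [l] there is a basis vector e_S for every set S of [l] indices of
    nonfaces, numbered by [enum_val]. *)
Definition taylor_rank (l : nat) : nat := #|[set S : {set 'I_n} | #|S| == l]%SET|.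
Definition taylor_basis (l : nat) (x : 'I_(taylor_rank l)) : {set 'I_n} :=
  enum_val x.

Lemma card_taylor_basis l (x : 'I_(taylor_rank l)) : #|taylor_basis x| = l.
Proof. by have := enum_valP x; rewrite inE => /eqP. Qed.

Lemma taylor_basis_surj l (S : {set 'I_n}) :
  #|S| = l -> exists x : 'I_(taylor_rank l), taylor_basis x = S.
Proof.
move=> Sl; have hS : S \in [set S : {set 'I_n} | #|S| == l]%SET by rewrite inE Sl.
by exists (enum_rank_in hS S); rewrite /taylor_basis enum_rankK_in.
Qed.

(** The coefficient of e_T in the differential of e_S. If T arises from S by deleting an index, it
    is up to sign the quotient of the least common multiples of the monomials in S and in T;
    otherwise it is 0. At most one [i] contributes. *)
Definition taylor_coef (S T : {set 'I_n}) : P :=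
  \sum_(i | (i \notin T) && (S == i |: T)%SET)
    (-1) ^+ sign_add i T * face_monomial k (U S :\: U T)%SET.

Definition taylor_diff l : 'M[P]_(taylor_rank l.+1, taylor_rank l) :=
  \matrix_(x, y) taylor_coef (taylor_basis x) (taylor_basis y).

(** Coordinates are extended by 0 to sets of all sizes; the sum has at most one term. *)
Definition taylor_coord l (u : 'rV[P]_(taylor_rank l)) (S : {set 'I_n}) : P :=
  \sum_(x | taylor_basis x == S) u 0 x.

(* Sending the basis vector e_S to x^(U S) embeds the Taylor complex into the
   chains of a simplex with coefficients in P, multidegree by multidegree. *)
Definition taylor_embed l (u : 'rV[P]_(taylor_rank l)) (S : {set 'I_n}) : P :=
  taylor_coord u S * face_monomial k (U S).

Lemma taylor_coord_basis l (u : 'rV[P]_(taylor_rank l)) x :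
  taylor_coord u (taylor_basis x) = u 0 x.
Proof.
rewrite /taylor_coord (big_pred1 x) // => y /=.
by rewrite (inj_eq enum_val_inj).
Qed.

Lemma taylor_coord_out l (u : 'rV[P]_(taylor_rank l)) (S : {set 'I_n}) :
  #|S| != l -> taylor_coord u S = 0.
Proof.
move=> Sl; rewrite /taylor_coord big1 // => x /eqP xS.
by rewrite -xS card_taylor_basis eqxx in Sl.
Qed.

Lemma taylor_coord_row l (q : {set 'I_n} -> P) (S : {set 'I_n}) :
  #|S| = l ->
  taylor_coord (\row_(x < taylor_rank l) q (taylor_basis x)) S = q S.
Proof. by move=> /taylor_basis_surj[x <-]; rewrite taylor_coord_basis mxE. Qed.

Lemma taylor_embed_inj l (u v : 'rV[P]_(taylor_rank l)) :
  taylor_embed u =1 taylor_embed v -> u = v.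
Proof.
move=> uv; apply/rowP => x; move: (uv (taylor_basis x)).
rewrite /taylor_embed !taylor_coord_basis; apply/mulIf/face_monomial_neq0.
Qed.

(** A nonzero entry from S to T, multiplied by x^(U T), is x^(U S) up to sign, so the embedding
    strips the differential of its monomial factors. *)
Lemma taylor_embed_diff l (u : 'rV[P]_(taylor_rank l.+1)) S :
  taylor_embed (u *m taylor_diff l) S = simplex_boundary (taylor_embed u) S.
Proof.
have [Sl | Sl] := eqVneq #|S| l; last first.
  rewrite /taylor_embed taylor_coord_out // mul0r /simplex_boundary big1 //.
  move=> i iS; rewrite taylor_coord_out ?mul0r ?mulr0 //.
  by rewrite cardsU1 iS add1n eqSS.
have [y <-] := taylor_basis_surj Sl; set T := taylor_basis y.
rewrite /taylor_embed taylor_coord_basis mxE /simplex_boundary mulr_suml.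
under eq_bigr => x _ do rewrite mxE /taylor_coef mulr_sumr mulr_suml big_mkcondr.
rewrite exchange_big; apply: eq_bigr => i iT /=.
rewrite /taylor_coord mulr_suml mulr_sumr [RHS]big_mkcond.
apply: eq_bigr => x _; case: eqP => // ->.
rewrite (@face_monomialD _ _ (U T) (U (i |: T)%SET)).
  by rewrite mulrCA !mulrA.
exact/union_nonfacesS/finset.subsetUr.
Qed.

Lemma taylor_diff_diff l (u : 'rV[P]_(taylor_rank l.+2)) :
  u *m taylor_diff l.+1 *m taylor_diff l = 0.
Proof.
apply: taylor_embed_inj => S; rewrite taylor_embed_diff.
rewrite /taylor_embed /taylor_coord big1 ?mul0r; last by move=> x _; rewrite mxE.
rewrite -[RHS](simplex_boundaryK (taylor_embed u) S).
by apply: eq_bigr => i _; rewrite -taylor_embed_diff.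
Qed.

(** Divisibility places each multidegree part of [c] on the simplex spanned by the nonfaces
    contained in the support of that multidegree. The condition at the empty set settles the
    multidegrees for which this simplex is empty. The last clause keeps [d] in a single homological
    degree when [c] is in one. *)
Lemma simplex_boundary_exact (c : {set 'I_n} -> P) :
  (forall S, exists q, c S = q * face_monomial k (U S)) ->
  c finset.set0 = 0 -> (forall S, simplex_boundary c S = 0) ->
  exists2 d : {set 'I_n} -> P,
    (forall S, exists q, d S = q * face_monomial k (U S)) &
    (forall S, simplex_boundary d S = c S) /\
    (forall S : {set 'I_n}, (forall i, i \in S -> c (S :\ i)%SET = 0) -> d S = 0).
Proof.
move=> cU c0 dc.
(* In multidegree b the chain lives on the simplex A b, which is contracted onto
   its least vertex. *)
pose A (b : mpoly.multinom m) := [set i | N i \subset mnm_supp b]%SET.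
pose least (i : 'I_n) b := (i \in A b) && [forall j in A b, (i <= j)%N].
have least_ex b : A b != finset.set0 -> exists i0, least i0 b.
  case/finset.set0Pn=> i iA.
  case: (@arg_minnP _ i (fun j => j \in A b) (fun j => val j) iA) => i0 i0A hi0.
  by exists i0; rewrite /least i0A; apply/'forall_implyP.
have leastP i b : least i b -> i \in A b /\ forall j, j \in A b -> (i <= j)%N.
  by move=> /andP[iA /'forall_implyP].
have cA (S : {set 'I_n}) b : mpoly.mcoeff b (c S) != 0 -> S \subset A b.
  have [q ->] := cU S; move=> /mcoeff_mul_face_monomial/fintype.subsetP hU.
  apply/fintype.subsetP => i iS; rewrite inE; apply/fintype.subsetP => x xN.
  by apply: hU; apply/finset.bigcupP; exists i.
(* The cones of all multidegrees are glued to one chain: the summand of [i] keeps the multidegrees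
   with apex [i]. *)
pose d (S : {set 'I_n}) := \sum_(i in S) mpoly_filter (least i) (c (S :\ i)%SET).
have d_least i0 b (S : {set 'I_n}) : least i0 b -> mpoly.mcoeff b (d S) =
    if i0 \in S then mpoly.mcoeff b (c (S :\ i0)%SET) else 0.
  move=> li0; rewrite /d raddf_sum /=.
  rewrite (eq_bigr (fun i => if i == i0 then mpoly.mcoeff b (c (S :\ i0)%SET) else 0)).
    rewrite -big_mkcondr; case: (boolP (i0 \in S)) => i0S.
      by rewrite (big_pred1 i0) // => i /=; rewrite andbC; case: eqP => // ->.
    by rewrite big1 // => i /andP[iS /eqP E]; rewrite -E iS in i0S.
  move=> i _; rewrite mcoeff_filter; case: eqP => [->|ne]; first by rewrite li0.
  case: ifP => // /leastP[iA imin]; have [i0A i0min] := leastP _ _ li0.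
  by case: ne; apply/val_inj/eqP; rewrite eqn_leq imin // i0min.
have bdE (e : {set 'I_n} -> P) b S : mpoly.mcoeff b (simplex_boundary e S) =
    simplex_boundary (fun T => mpoly.mcoeff b (e T)) S.
  rewrite /simplex_boundary raddf_sum; apply: eq_bigr => i _ /=.
  by rewrite !mulr_sign; case: ifP => _ //; rewrite raddfN.
have d_empty b (S : {set 'I_n}) : A b = finset.set0 -> mpoly.mcoeff b (d S) = 0.
  move=> A0; rewrite /d raddf_sum big1 // => i _.
  by rewrite /= mcoeff_filter /least A0 finset.in_set0.
have c_empty b (S : {set 'I_n}) : A b = finset.set0 -> mpoly.mcoeff b (c S) = 0.
  move=> A0; apply/eqP; apply: contraTT isT => nz.
  have := cA _ _ nz; rewrite A0 finset.subset0 => /eqP S0.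
  by move: nz; rewrite S0 c0 mpoly.mcoeff0 eqxx.
exists d => [S|].
  apply: face_monomial_factor => b.
  have [/d_empty->|/least_ex[i0 li0]] := eqVneq (A b) finset.set0; first by rewrite eqxx.
  rewrite (d_least _ _ _ li0); case: ifP => [i0S /cA SA|]; last by rewrite eqxx.
  have {}SA : S \subset A b.
    by rewrite -(finset.setD1K i0S) finset.subUset finset.sub1set SA (leastP _ _ li0).1.
  apply/finset.bigcupsP => i /(fintype.subsetP SA); by rewrite inE.
split=> [S|S h]; last first.
  rewrite /d big1 // => i /h ->; apply/mpoly.mpolyP => b.
  by rewrite mcoeff_filter mpoly.mcoeff0 if_same.
apply/mpoly.mpolyP => b; rewrite bdE.
have [A0|/least_ex[i0 li0]] := eqVneq (A b) finset.set0.
  rewrite c_empty // /simplex_boundary big1 // => i _.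
  by rewrite d_empty // mulr0.
have [i0A i0min] := leastP _ _ li0.
rewrite -(@simplex_boundary_cone _ _ (fun T => mpoly.mcoeff b (c T)) (A b) i0) //.
- by apply: eq_bigr => i _; rewrite (d_least _ _ _ li0).
- by move=> T; apply: cA.
- by move=> T; rewrite -bdE dc mpoly.mcoeff0.
Qed.

Definition taylor_deg l (x : 'I_(taylor_rank l)) : nat := #|U (taylor_basis x)|.

Definition taylor_aug : 'cV[P]_(taylor_rank 0) := const_mx 1.

Lemma taylor_aug_homog (x : 'I_(taylor_rank 0)) :
  taylor_aug x 0 \is @mpoly.ishomog1 m k (taylor_deg x) (@mpoly.mdeg m).
Proof.
rewrite mxE /taylor_deg; have /eqP := card_taylor_basis x.
rewrite finset.cards_eq0 => /eqP ->.
by rewrite /union_nonfaces finset.big_set0 cards0; exact: mpoly.dhomog1.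
Qed.

Lemma taylor_diff_homog l x y : taylor_diff l x y != 0 ->
  exists2 e, taylor_deg x = (taylor_deg y + e)%N &
    taylor_diff l x y \is @mpoly.ishomog1 m k e (@mpoly.mdeg m).
Proof.
rewrite mxE /taylor_deg; set S := taylor_basis x; set T := taylor_basis y => nz.
have TS : T \subset S.
  apply: contraNT nz => TS; rewrite /taylor_coef big1 // => i /andP[_ /eqP E].
  by rewrite E finset.subsetUr in TS.
exists #|(U S :\: U T)%SET|.
  by rewrite cardsD (finset.setIidPr (union_nonfacesS TS)) subnKC //
    subset_leq_card // union_nonfacesS.
apply: rpred_sum => i _; rewrite mulr_sign; case: ifP => _; rewrite ?rpredN;
  exact: face_monomial_homogeneous.
Qed.

Lemma taylor_augE (u : 'rV[P]_(taylor_rank 0)) :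
  (u *m taylor_aug) 0 0 = taylor_embed u finset.set0.
Proof.
rewrite mxE /taylor_embed /union_nonfaces finset.big_set0 face_monomial0 mulr1.
rewrite /taylor_coord; apply: eq_big => [x|x _]; last by rewrite mxE mulr1.
by rewrite -finset.cards_eq0 card_taylor_basis.
Qed.

Lemma taylor_aug_surj (p : P) :
  exists u : 'rV[P]_(taylor_rank 0), sr_ideal K (p - (u *m taylor_aug) 0 0).
Proof.
exists (\row_x p); rewrite taylor_augE /taylor_embed.
rewrite (taylor_coord_row (fun=> p)) ?cards0 //.
rewrite /union_nonfaces finset.big_set0 face_monomial0 mulr1 subrr.
exact: sr_ideal0.
Qed.

Lemma union_nonfaces1 i : U [set i]%SET = N i.
Proof. by rewrite /union_nonfaces finset.big_set1. Qed.

(** Every generator of the ideal is a multiple of some x^(N i), and x^(N i) is the differential of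
    the basis vector of the singleton of [i]. *)
Lemma taylor_aug_exact (u : 'rV[P]_(taylor_rank 0)) :
  sr_ideal K ((u *m taylor_aug) 0 0) <->
  exists w : 'rV[P]_(taylor_rank 1), u = w *m taylor_diff 0.
Proof.
rewrite taylor_augE; split=> [|[w ->]]; last first.
  rewrite taylor_embed_diff /simplex_boundary; elim/big_ind: _ => [||i _].
  - exact: sr_ideal0.
  - exact: sr_idealD.
  - rewrite finset.setU0 /taylor_embed union_nonfaces1 mulrA; apply: sr_idealM.
    by apply: sr_ideal_nonface; apply/nonfaceP; exists i.
move=> [c E].
have [q Eq] : exists q : 'I_n -> P,
    taylor_embed u finset.set0 = \sum_i q i * face_monomial k (N i).
  rewrite E; apply: (big_ind (fun p : P => exists q : 'I_n -> P,
      p = \sum_i q i * face_monomial k (N i)))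
    => [|p1 p2 [q1 ->] [q2 ->]|I /nonfaceP[i NI]].
  - by exists (fun=> 0); rewrite big1 // => i _; rewrite mul0r.
  - exists (fun i => q1 i + q2 i); rewrite -big_split.
    by apply: eq_bigr => i _; rewrite mulrDl.
  - exists (fun j => if j == i then c I * face_monomial k (I :\: N i)%SET else 0).
    rewrite (bigD1 i) //= eqxx big1 ?addr0.
      by rewrite (face_monomialD k NI) mulrA.
    by move=> j /negbTE ->; rewrite mul0r.
(* The basis sets are singletons here, so the sum is a single [q i]. *)
exists (\row_x \sum_(i in taylor_basis x) q i).
apply: taylor_embed_inj => S; rewrite taylor_embed_diff.
have [/eqP|S0] := eqVneq #|S| 0%N; last first.
  rewrite {1}/taylor_embed taylor_coord_out // mul0r /simplex_boundary big1 // => i iS.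
  by rewrite /taylor_embed taylor_coord_out ?mul0r ?mulr0 // cardsU1 iS add1n eqSS.
rewrite finset.cards_eq0 => /eqP ->; rewrite Eq /simplex_boundary.
apply: eq_big => [i|i _]; first by rewrite finset.in_set0.
rewrite finset.setU0 /taylor_embed union_nonfaces1.
rewrite (taylor_coord_row (fun S => \sum_(i in S) q i)) ?cards1 // finset.big_set1.
rewrite (_ : sign_add i finset.set0 = false) ?mul1r // /sign_add.
by rewrite (_ : [set _ in _ | _]%SET = finset.set0) ?cards0 //;
  apply/finset.setP => j; rewrite !inE.
Qed.

Lemma taylor_diff_exact l (u : 'rV[P]_(taylor_rank l.+1)) :
  u *m taylor_diff l = 0 <->
  exists w : 'rV[P]_(taylor_rank l.+2), u = w *m taylor_diff l.+1.
Proof.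
split=> [ud|[w ->]]; last exact: taylor_diff_diff.
have [|||d dU [dd d0]] := @simplex_boundary_exact (taylor_embed u).
- by move=> S; exists (taylor_coord u S).
- by rewrite /taylor_embed taylor_coord_out ?mul0r ?cards0.
- move=> S; rewrite -taylor_embed_diff ud /taylor_embed /taylor_coord.
  by rewrite big1 ?mul0r // => x _; rewrite mxE.
have [q hq] := choice dU.
exists (\row_x q (taylor_basis x)); apply: taylor_embed_inj => S.
rewrite taylor_embed_diff -dd; apply: eq_bigr => i iS; congr (_ * _).
(* Only sets of size l + 2 have a coordinate; at the others [d] vanishes by its last property. *)
set T := (i |: S)%SET; rewrite /taylor_embed.
have [Tl|Tl] := eqVneq #|T| l.+2; first by rewrite taylor_coord_row // -hq.
rewrite taylor_coord_out // mul0r; apply: d0 => j jT.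
rewrite /taylor_embed taylor_coord_out ?mul0r //.
by apply: contra Tl => /eqP E; rewrite (cardsD1 j) jT E.
Qed.

Definition taylor_resolution : resolution k K :=
  Resolution taylor_aug_homog taylor_diff_homog taylor_aug_surj
    taylor_aug_exact taylor_diff_exact.

(** The variable of a private vertex of the deleted nonface divides each entry of the differential,
    so the Taylor resolution is minimal. [tor_dim_minimal] then gives the same value for all
    resolutions, and [xget] chooses from a singleton. *)
Lemma betti_taylor (l j : nat) :
  (forall i, exists2 x, x \in N i & forall i', x \in N i' -> i' = i) ->
  betti k K l j = #|[set S : {set 'I_n} | (#|S| == l) && (#|U S| == j)]%SET|.
Proof.
move=> priv.
have T0 l' : tor_diff taylor_resolution l' = 0.
  apply/matrixP => x y; rewrite !mxE /= /taylor_coef raddf_sum.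
  rewrite big1 // => i /andP[iT /eqP ->].
  have [z zN zi] := priv i.
  rewrite /= mulr_sign; set p := face_monomial _ _.
  suff p0 : mpoly.meval (fun=> 0) p = 0.
    by case: ifP => _; rewrite ?mpoly.mevalN p0 ?oppr0.
  rewrite /p /face_monomial rmorph_prod (bigD1 z) /=; last first.
    rewrite inE; apply/andP; split; last first.
      by apply/finset.bigcupP; exists i; rewrite ?finset.setU11.
    apply/finset.bigcupP => -[i' i'T /zi E].
    by rewrite -E i'T in iT.
  by rewrite mpoly.mevalXU mul0r.
have cardE : #|[pred x : 'I_(res_rank taylor_resolution l) | res_deg x == j]| =
    #|[set S : {set 'I_n} | (#|S| == l) && (#|U S| == j)]%SET|.
  rewrite -sum1_card -sum1_card.
  transitivity (\sum_(x < taylor_rank l | #|U (taylor_basis x)| == j) 1)%N.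
    by apply: eq_bigl => x; rewrite inE.
  rewrite -(big_enum_val_cond (fun S : {set 'I_n} => #|U S| == j) (fun=> 1%N)).
  by apply: eq_bigl => S; rewrite !inE.
rewrite /betti; apply: xget_unique => [|b [F ->]].
  by exists taylor_resolution; rewrite (tor_dim_minimal _ _ _ T0) cardE.
by rewrite (tor_dim_minimal _ _ _ T0) cardE.
Qed.
End Taylor.

(** * Buchstaber invariants *)


(** The default value 0 satisfies every bound. *)
Lemma max_nat_le (A : set nat) b :
  (forall r, A r -> (r <= b)%N) -> (max_nat A <= b)%N.
Proof. by move=> Ab; rewrite /max_nat; case: xgetP => // s _ [/Ab]. Qed.

(** The bound guarantees a maximum, so the default value does not occur. *)
Lemma max_nat_ge (A : set nat) b r :
  (forall s, A s -> (s <= b)%N) -> A r -> (r <= max_nat A)%N.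
Proof.
move=> Ab Ar.
have ex : exists s, `[< A s >] by exists r; apply/asboolP.
have ub s : `[< A s >] -> (s <= b)%N by move/asboolP/Ab.
have [s /asboolP As smax] := ex_maxnP ex ub.
have /(xgetPex 0%N)[_] : exists s, A s /\ forall r, A r -> (r <= s)%N.
  by exists s; split=> // t /asboolP/smax.
by apply.
Qed.

Lemma continuous_rV (K : numFieldType) (T : topologicalType) n (f : T -> 'rV[K]_n) :
  (forall j, continuous (fun x => f x 0 j)) -> continuous f.
Proof.
move=> fc x A [P Pf PA]; apply: (@filterS _ (nbhs x) _
  [set y | forall j : 'I_n, P 0 j (f y 0 j)]) => [y hy|].
  by apply: PA => i j; rewrite ord1.
by apply: filter_forall => j; apply: fc; apply: Pf.
Qed.

Section Buchstaber.
Variables (R : realType) (m n : nat) (N : 'I_n -> {set 'I_m}).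
Hypothesis N_neq0 : forall i, N i != finset.set0.
Local Notation C := [the numClosedFieldType of R[i]].
Local Notation K := (complex_of_nonfaces N_neq0).

(** Otherwise the support of [g] is a face, and the point with coordinates 0 on the support and 1
    off it lies in the moment-angle complex and is fixed by [g]. *)
Lemma acts_freely_support (G : set 'rV[C]_m) g : acts_freely K G -> G g ->
  g != const_mx 1 -> exists i, forall x, x \in N i -> g 0 x != 1.
Proof.
move=> free Gg /eqP g1.
have : [set x | g 0 x != 1]%SET \notin faces K.
  apply/negP => supp; apply: g1.
  apply: (free g (\row_x (g 0 x == 1)%:R)) => //; last first.
    apply/rowP => x; rewrite !mxE; case: eqP => [->|_]; rewrite ?mulr1 ?mulr0 //.
  exists [set x | g 0 x != 1]%SET => // x; rewrite mxE inE negbK.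
  split=> [|->]; last by rewrite normr1.
  by case: eqP; rewrite ?normr1 ?normr0.
move=> /nonfaceP[i /fintype.subsetP Ni]; exists i => x /Ni.
by rewrite inE.
Qed.

(** Off the face [I] a fixed point has nonzero coordinates, where [g] must be 1. Thus [I] contains
    the support of [g], hence a nonface. *)
Lemma support_acts_freely (G : set 'rV[C]_m) :
  (forall g, G g -> g != const_mx 1 ->
     exists i, forall x, x \in N i -> g 0 x != 1) -> acts_freely K G.
Proof.
move=> hG g z Gg [I IK hz] gz; apply/eqP; apply: contraT => /(hG _ Gg)[i Ni].
suff : I \notin faces K by rewrite IK.
apply/nonfaceP; exists i; apply/fintype.subsetP => x /Ni.
apply: contraR => /(hz x).2 zx.
have z0 : z 0 x != 0 by rewrite -normr_eq0 zx oner_neq0.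
by move/rowP: gz => /(_ x); rewrite mxE => /(canRL (mulfK z0)); rewrite divff // => ->.
Qed.

Lemma real_acts_freely_support (G : {vspace 'rV['F_2]_m}) g :
  real_acts_freely R K G -> g \in G -> g != 0 ->
  exists i, forall x, x \in N i -> g 0 x != 0.
Proof.
move=> free Gg /eqP g1.
have : [set x | g 0 x != 0]%SET \notin faces K.
  apply/negP => supp; apply: g1.
  apply: (free g (\row_x (g 0 x == 0)%:R)) => //; last first.
    apply/rowP => x; rewrite !mxE; case: eqP => [->|_]; rewrite ?mulr0 //.
    by rewrite mulr1 expr0.
  exists [set x | g 0 x != 0]%SET => // x; rewrite mxE inE negbK.
  split=> [|->]; last by right.
  by case: eqP => _; rewrite ?lexx ?ler01 ?lerN10 ?(le_trans (lerN10 _)) ?ler01.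
move=> /nonfaceP[i /fintype.subsetP Ni]; exists i => x /Ni.
by rewrite inE.
Qed.

Lemma F2_neq0 (a : 'F_2) : (a != 0) = (a == 1).
Proof. by case: a => [[|[|//]]]. Qed.

Lemma support_real_acts_freely (G : {vspace 'rV['F_2]_m}) :
  (forall g, g \in G -> g != 0 ->
     exists i, forall x, x \in N i -> g 0 x != 0) -> real_acts_freely R K G.
Proof.
move=> hG g z Gg [I IK hz] gz; apply/eqP; apply: contraT => /(hG _ Gg)[i Ni].
suff : I \notin faces K by rewrite IK.
apply/nonfaceP; exists i; apply/fintype.subsetP => x /Ni.
rewrite F2_neq0 => /eqP gx; apply: contraT => /(hz x).2 zx.
move/rowP: gz => /(_ x); rewrite mxE gx expr1 mulN1r => /eqP.
rewrite eq_sym -subr_eq0 opprK -mulr2n mulrn_eq0 /= => /eqP z0.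
by case: zx => /eqP; rewrite z0 eq_sym ?oppr_eq0 oner_eq0.
Qed.

(** The elements of the torus with square 1, encoded by their exponents. *)
Definition sign_vector (C' : pzRingType) r (b : {ffun 'I_r -> bool}) : 'rV[C']_r :=
  \row_x (-1) ^+ b x.

Definition addff r (b c : {ffun 'I_r -> bool}) : {ffun 'I_r -> bool} :=
  [ffun x => b x (+) c x].

Lemma sign_vectorD (C' : pzRingType) r (b c : {ffun 'I_r -> bool}) :
  sign_vector C' (addff b c) = coord_mul (sign_vector C' b) (sign_vector C' c).
Proof. by apply/rowP => x; rewrite !mxE ffunE signr_addb. Qed.

Lemma sign_vector_inj r : injective (@sign_vector C r).
Proof.
move=> b c /rowP E; apply/ffunP => x; move: (E x); rewrite !mxE.
by move/eqP; rewrite (inj_eq (@signr_inj _)) => /eqP.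
Qed.

Lemma sign_vector_torus r (b : {ffun 'I_r -> bool}) : torus (sign_vector C b).
Proof. by move=> x; rewrite mxE normr_sign. Qed.

(** The isomorphism with the torus of rank [r] carries its 2-torsion to elements with square 1,
    whose coordinates are signs. This reduces upper bounds on the rank to sign vectors. *)
Lemma toric_subgroup_signs r (G : set 'rV[C]_m) : toric_subgroup r G ->
  exists s : {ffun 'I_r -> bool} -> {ffun 'I_m -> bool},
    [/\ injective s, forall b, G (sign_vector C (s b)) &
        forall b c, s (addff b c) = addff (s b) (s c)].
Proof.
move=> [GT [phi [psi [phiG phiK phiM _ _]]]].
pose e b := sign_vector C b : 'rV[C]_r.
have eT b : e b \in @torus R r by apply/mem_set/sign_vector_torus.
have phiT b : torus (phi (e b)).
  by apply: GT; rewrite -phiG; exists (e b) => //; apply: sign_vector_torus.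
(* The square of a sign vector is neutral, so that of its image is the image of the neutral element;
   this image is its own square and therefore 1 in each coordinate. *)
have sq b : coord_mul (phi (e b)) (phi (e b)) = phi (e [ffun=> false]).
  rewrite -phiM // -sign_vectorD; congr (phi (e _)).
  by apply/ffunP => x; rewrite !ffunE addbb.
have nz (z : C) : `|z| = 1 -> z != 0 by move=> z1; rewrite -normr_eq0 z1 oner_neq0.
have phi1 x : phi (e [ffun=> false]) 0 x = 1.
  have /rowP/(_ x) := sq [ffun=> false]; rewrite mxE.
  by move=> /(canRL (mulfK (nz _ (phiT _ x)))); rewrite divff // nz // phiT.
have pm b x : (phi (e b) 0 x == 1) || (phi (e b) 0 x == -1).
  by rewrite -sqrf_eq1; have /rowP/(_ x) := sq b; rewrite mxE phi1 expr2 => ->.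
pose s b : {ffun 'I_m -> bool} := [ffun x => phi (e b) 0 x != 1].
have phis b : sign_vector C (s b) = phi (e b).
  apply/rowP => x; rewrite mxE ffunE; case/orP: (pm b x) => /eqP ->.
    by rewrite eqxx.
  by rewrite lt_eqF // (lt_trans (ltrN10 _)) ?ltr01.
exists s; split=> [b c E|b|b c].
- apply: (@sign_vector_inj r); apply: (can_in_inj phiK); rewrite ?eT //.
  by rewrite -/(e b) -/(e c) -!phis E.
- by rewrite phis -phiG; exists (e b) => //; apply: sign_vector_torus.
- apply: (@sign_vector_inj m); rewrite phis sign_vectorD !phis -phiM //.
  by rewrite -sign_vectorD.
Qed.

(** The injection of sign vectors gives 2^r <= 2^m. *)
Lemma toric_subgroup_rank r (G : set 'rV[C]_m) : toric_subgroup r G -> (r <= m)%N.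
Proof.
move=> /toric_subgroup_signs[s [/leq_card + _ _]].
by rewrite !card_ffun card_bool !card_ord leq_exp2l.
Qed.

Lemma real_rank (G : {vspace 'rV['F_2]_m}) : (\dim G <= m)%N.
Proof. by have := dimvS (subvf G); rewrite dimvf /dim /= mul1n. Qed.

(** * Upper bound when any three nonfaces meet *)

Section Small.
Hypothesis N_meet : forall i j l, exists x, [/\ x \in N i, x \in N j & x \in N l].

Lemma real_buchstaber_le1 : (real_buchstaber R K <= 1)%N.
Proof.
apply: max_nat_le => r [G -> free]; rewrite leqNgt; apply/negP => dG.
have supp g := real_acts_freely_support free (g := g).
have G0 : G != 0%VS by rewrite -dimv_eq0 -lt0n ltnW.
have aG := memv_pick G; have : vpick G != 0 by rewrite vpick0.
move: (vpick G) aG => a aG a0.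
(* A line has dimension at most 1, so the group contains a second, independent element. *)
have [b bG bna] : exists2 b, b \in G & b \notin <[a]>%VS.
  apply/subvPn; apply: contraL dG => /dimvS; rewrite -leqNgt => /leq_trans; apply.
  by rewrite dim_vline; case: eqP.
have b0 : b != 0 by apply: contraNneq bna => ->; exact: mem0v.
have ab0 : a + b != 0.
  apply: contraNneq bna => /eqP; rewrite addrC addr_eq0 => /eqP ->.
  by rewrite memvN memv_line.
have [[i hi] [j hj]] := (supp _ aG a0, supp _ bG b0).
have [l hl] := supp _ (memvD aG bG) ab0.
(* At a common vertex [a] and [b] have entry 1, so that [a + b] has entry 0. *)
have [x [/hi ax /hj bx /hl]] := N_meet i j l.
move: ax bx; rewrite mxE !F2_neq0 => /eqP -> /eqP ->.
by rewrite -F2_neq0.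
Qed.

Lemma buchstaber_le1 : (buchstaber R K <= 1)%N.
Proof.
apply: max_nat_le => r [G /toric_subgroup_signs[s [s_inj sG sD]] free].
rewrite leqNgt; apply/negP => r1.
(* As r > 1, the first two standard generators exist; [s] carries them and their sum to nontrivial
   sign vectors. *)
pose b1 : {ffun 'I_r -> bool} := [ffun x => x == Ordinal (ltnW r1)].
pose b2 : {ffun 'I_r -> bool} := [ffun x => x == Ordinal r1].
pose z r' : {ffun 'I_r' -> bool} := [ffun => false].
have s0 : s (z r) = z m.
  have <- : addff (z r) (z r) = z r by apply/ffunP => x; rewrite !ffunE.
  by rewrite sD; apply/ffunP => x; rewrite !ffunE addbb.
have supp (b : {ffun 'I_r -> bool}) : b != z r -> exists i, forall x, x \in N i -> s b x.
  move=> bz; have [|i hi] := acts_freely_support free (sG b).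
    apply: contra bz => /eqP E; rewrite -(inj_eq s_inj) s0.
    rewrite -(inj_eq (@sign_vector_inj m)) E.
    by apply/eqP/rowP => x; rewrite !mxE ffunE.
  by exists i => x /hi; rewrite mxE; case: (s b x) => //; rewrite eqxx.
have nz (b : {ffun 'I_r -> bool}) x : b x -> b != z r.
  by move=> bx; apply: contraTneq bx => ->; rewrite ffunE.
have [i hi] : exists i, forall x, x \in N i -> s b1 x.
  by apply/supp/(nz _ (Ordinal (ltnW r1))); rewrite ffunE.
have [j hj] : exists j, forall x, x \in N j -> s b2 x.
  by apply/supp/(nz _ (Ordinal r1)); rewrite ffunE.
have [l hl] : exists l, forall x, x \in N l -> s (addff b1 b2) x.
  by apply/supp/(nz _ (Ordinal r1)); rewrite !ffunE.
have [x [/hi h1 /hj h2 /hl]] := N_meet i j l.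
by rewrite sD ffunE h1 h2.
Qed.
End Small.

(** * Free subgroups of rank 2 from three nonfaces without a common vertex *)

Section Large.
Variables (i j l : 'I_n) (xu xt : 'I_m).
Hypothesis N_disjoint : forall x, x \in N i -> x \in N j -> x \in N l -> False.
Hypotheses (xui : xu \in N i) (xuj : xu \in N j).
Hypotheses (xti : xt \notin N i) (xtj : xt \in N j).

(* The weights are chosen so that the support of (u, t) contains N j if both
   parameters are nontrivial, N i if only u is, and N l if only t is. *)
Definition rank2_weight (T : Type) (op : T -> T -> T) (u t : T) (x : 'I_m) : T :=
  if x \in N j then if x \in N i then u else t else op u t.

(** An arbitrary operation with neutral element [e] covers both addition in ['F_2] and
    multiplication of complex numbers. *)
Lemma rank2_weight_support (T : eqType) (op : T -> T -> T) (e u t : T) :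
  left_id e op -> right_id e op -> (u != e) || (t != e) ->
  exists i', forall x, x \in N i' -> rank2_weight op u t x != e.
Proof.
move=> op1 op2; rewrite /rank2_weight.
have [->|u1] := eqVneq u e; have [->|t1] := eqVneq t e => //= _.
- exists l => x xl; rewrite op1; case: ifP => // xj; case: ifP => // xi.
  by case: (N_disjoint xi xj xl).
- by exists i => x xi; rewrite op2 xi; case: ifP.
- by exists j => x ->; case: ifP.
Qed.

Lemma real_buchstaber_ge2 : (2 <= real_buchstaber R K)%N.
Proof.
apply: (max_nat_ge (b := m)) => [r [G -> _]|]; first exact: real_rank.
pose v (u t : 'F_2) : 'rV['F_2]_m := \row_x rank2_weight +%R u t x.
have vD a b : v a b = a *: v 1 0 + b *: v 0 1.
  apply/rowP => x; rewrite !mxE /rank2_weight.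
  by case: ifP => _; [case: ifP => _|];
    rewrite ?addr0 ?add0r ?mulr0 ?mulr1 ?addr0 ?add0r.
exists <<[:: v 1%R 0%R; v 0%R 1%R]>>%VS.
  (* Independence is read off at [xu], where the weight is u, and at [xt], where it is t. *)
  apply/esym/eqP; change (free [:: v 1 0; v 0 1]).
  rewrite free_cons seq1_free span_seq1; apply/andP; split.
    apply/vlineP => -[c /rowP/(_ xu)]; rewrite !mxE /rank2_weight xui xuj mulr0.
    by move/eqP; rewrite oner_eq0.
  apply/eqP => /rowP/(_ xt); rewrite !mxE /rank2_weight (negbTE xti) xtj.
  by move/eqP; rewrite oner_eq0.
apply: support_real_acts_freely => g; rewrite span_cons span_seq1.
move=> /memv_addP[_ /vlineP[a ->] [_ /vlineP[b ->] ->]]; rewrite -vD => v0.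
have [|i' hi'] := @rank2_weight_support _ +%R 0 a b (@add0r _) (@addr0 _).
  apply: contraNT v0; rewrite negb_or !negbK => /andP[/eqP -> /eqP ->].
  by rewrite vD !scale0r addr0.
by exists i' => x /hi'; rewrite mxE.
Qed.

Lemma buchstaber_ge2 : (2 <= buchstaber R K)%N.
Proof.
apply: (max_nat_ge (b := m)) => [r [G hG _]|]; first exact: toric_subgroup_rank hG.
pose phi (s : 'rV[C]_2) : 'rV[C]_m :=
  \row_x rank2_weight *%R (s 0 0) (s 0 1) x.
(* The coordinates at [xu] and [xt] return the two parameters, so [psi] inverts [phi] on the
   torus. *)
pose psi (z : 'rV[C]_m) : 'rV[C]_2 := \row_y (if y == 0 then z 0 xu else z 0 xt).
have phi_torus s : torus s -> torus (phi s).
  move=> hs x; rewrite mxE /rank2_weight.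
  by case: ifP => _; [case: ifP => _|]; rewrite ?normrM !hs ?mulr1.
exists (phi @` @torus R 2).
  split=> [_ [s hs <-]|]; first exact: phi_torus.
  exists phi, psi; split=> //.
  - move=> s _; apply/rowP => y; rewrite !mxE /rank2_weight xui xuj (negbTE xti) xtj.
    by case: y => [[|[|//]]] p /=; congr (s 0 _); apply: val_inj.
  - move=> s t _ _; apply/rowP => x; rewrite !mxE /rank2_weight.
    by case: ifP => _; [case: ifP => _|] => //; rewrite mulrACA.
  - apply: continuous_subspaceT; apply: continuous_rV => x.
    have -> : (fun s => phi s 0 x) =
        (fun s => rank2_weight *%R (s 0 0) (s 0 1) x).
      by apply/funext => s; rewrite mxE.
    rewrite /rank2_weight; case: (x \in N j); [case: (x \in N i)|] => s.
    + exact: coord_continuous.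
    + exact: coord_continuous.
    + by apply: continuousM; exact: coord_continuous.
  - apply: continuous_subspaceT; apply: continuous_rV => y.
    have -> : (fun z => psi z 0 y) = (fun z => z 0 (if y == 0 then xu else xt)).
      by apply/funext => z; rewrite mxE; case: ifP.
    exact: coord_continuous.
apply: support_acts_freely => _ [s hs <-] s1.
have [|i' hi'] := @rank2_weight_support _ *%R 1 (s 0 0) (s 0 1) (@mul1r _) (@mulr1 _).
  apply: contraNT s1; rewrite negb_or !negbK => /andP[/eqP s0 /eqP s1].
  by apply/eqP/rowP => x; rewrite !mxE s0 s1 /rank2_weight mulr1 !if_same.
by exists i' => x /hi'; rewrite mxE.
Qed.
End Large.
End Buchstaber.

(** * The two complexes *)

Section DimensionColouring.
Variables (m n : nat) (N : 'I_n -> {set 'I_m}).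
Hypothesis N_neq0 : forall i, N i != finset.set0.
Local Notation K := (complex_of_nonfaces N_neq0).

(** The complement of {x, y} contains no nonface, so it is a face with m - 2 vertices. A larger set
    omits at most one vertex z and contains a nonface avoiding z. *)
Lemma dim_complex_of_nonfaces (x y : 'I_m) : x != y ->
  (forall i, (x \in N i) || (y \in N i)) ->
  (forall z, exists i, z \notin N i) -> dim_complex K = m%:Z - 3.
Proof.
move=> xy cover nocommon.
have m2 : (2 <= m)%N.
  by have := max_card (pred_of_set [set x; y]%SET); rewrite cards2 xy card_ord.
have face_xy : (~: [set x; y])%SET \in faces K.
  apply: contraT => /nonfaceP[i /fintype.subsetP Ni].
  by case/orP: (cover i) => /Ni; rewrite !inE eqxx ?orbT.
have card_xy : #|(~: [set x; y])%SET| = (m - 2)%N.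
  by rewrite cardsCs finset.setCK cards2 xy card_ord.
rewrite /dim_complex; have -> : (\max_(I in faces K) #|I| = m - 2)%N.
  apply/eqP; rewrite eqn_leq; apply/andP; split; last first.
    by rewrite -card_xy; apply: leq_bigmax_cond.
  apply/bigmax_leqP => I IK; rewrite leqNgt; apply/negP => lt.
  have : (#|(~: I)%SET| <= 1)%N by rewrite cardsCs finset.setCK card_ord; lia.
  move/card_le1_eqP => h.
  (* If nothing is omitted, any vertex serves as [z]. *)
  have [z zI] : exists z, (~: I)%SET \subset [set z]%SET.
    have [/eqP|[z zI]] := set_0Vmem (~: I)%SET.
      by move=> /eqP ->; exists x; apply: finset.sub0set.
    exists z; apply/fintype.subsetP => w wI; rewrite inE; apply/eqP; exact: h.
  have [i zN] := nocommon z.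
  suff : I \notin faces K by rewrite IK.
  apply/nonfaceP; exists i; apply/fintype.subsetP => w wN.
  apply: contraNT zN => wI; suff /eqP <- : w == z by [].
  by have := fintype.subsetP zI w; rewrite !inE; apply.
by rewrite -subzn // -addrA.
Qed.

(** Nonfaces have at least three vertices, so all pairs are faces and colourings are injective. *)
Lemma chromatic_number_complex_of_nonfaces :
  (forall i, (2 < #|N i|)%N) -> chromatic_number K = m.
Proof.
move=> N3; rewrite /chromatic_number; case: ex_minnP => c /existsP[f /forallP hf] cmin.
apply/eqP; rewrite eqn_leq; apply/andP; split.
  apply: cmin; apply/existsP; exists [ffun i => i].
  by apply/forallP => i; apply/forallP => j; rewrite !ffunE; apply/implyP => /andP[].
suff /leq_card : injective f by rewrite !card_ord.
move=> a b fab; apply/eqP; apply: contraT => ab.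
have /forallP/(_ b)/implyP := hf a; rewrite fab eqxx ab; apply.
apply: contraT => /nonfaceP[i /subset_leq_card].
by rewrite cards2 ab leqNgt N3.
Qed.
End DimensionColouring.

(** This and the next two lemmas move cardinalities and quantifiers from finite types to lists of
    numbers, where they can be evaluated. *)
Lemma card_set_ord n (p : pred nat) :
  #|[set x : 'I_n | p x]%SET| = count p (iota 0 n).
Proof.
rewrite -sum1_card -sum1_count -[n in iota 0 n]subn0 -/(index_iota 0 n) big_mkord.
by apply: eq_bigl => x; rewrite inE.
Qed.

Lemma all_ord n (p : pred nat) : all p (iota 0 n) -> forall x : 'I_n, p x.
Proof. by move=> /allP h x; apply: h; rewrite mem_iota /=. Qed.

Lemma has_ord n (p : pred nat) : has p (iota 0 n) -> exists x : 'I_n, p x.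
Proof.
by move=> /hasP[x]; rewrite mem_iota => /= xn px; exists (Ordinal xn).
Qed.

(* Entry x of a table lists the indices i of the minimal nonfaces through the
   vertex x. *)
Definition table_nonface (t : seq (seq nat)) (i : 'I_4) : {set 'I_10} :=
  [set x : 'I_10 | (i : nat) \in nth [::] t x]%SET.

Definition table1 : seq (seq nat) :=
  [:: [:: 0]; [:: 1]; [:: 2]; [:: 3]; [:: 0; 1]; [:: 0; 2];
      [:: 1; 2; 3]; [:: 1; 2; 3]; [:: 0; 2; 3]; [:: 0; 1; 3]]%N.

Definition table2 : seq (seq nat) :=
  [:: [:: 0]; [:: 1]; [:: 2]; [:: 3]; [:: 0; 1]; [:: 2; 3];
      [:: 1; 2; 3]; [:: 0; 2; 3]; [:: 0; 1; 3]; [:: 0; 1; 2]]%N.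

Lemma card_table_nonface t i :
  #|table_nonface t i| = count (fun x => (i : nat) \in nth [::] t x) (iota 0 10).
Proof. exact: card_set_ord. Qed.

Lemma card_table1 i : (2 < #|table_nonface table1 i|)%N.
Proof. by rewrite card_table_nonface; case: i => [[|[|[|[|]]]]]. Qed.

Lemma card_table2 i : (2 < #|table_nonface table2 i|)%N.
Proof. by rewrite card_table_nonface; case: i => [[|[|[|[|]]]]]. Qed.

Lemma table1_neq0 i : table_nonface table1 i != finset.set0.
Proof. by rewrite -card_gt0 (leq_trans _ (card_table1 i)). Qed.

Lemma table2_neq0 i : table_nonface table2 i != finset.set0.
Proof. by rewrite -card_gt0 (leq_trans _ (card_table2 i)). Qed.

(** The first four vertices are the private ones. *)
Lemma table_private t :
  (forall i : 'I_4, nth [::] t i = [:: (i : nat)]) ->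
  forall i, exists2 x, x \in table_nonface t i &
    forall i', x \in table_nonface t i' -> i' = i.
Proof.
move=> ht i; exists (widen_ord (isT : 4 <= 10)%N i); first by rewrite inE ht inE.
by move=> i'; rewrite inE ht inE => /eqP/val_inj.
Qed.

Lemma table_nocommon t :
  all (fun z => has (fun i => i \notin nth [::] t z) (iota 0 4)) (iota 0 10) ->
  forall z, exists i, z \notin table_nonface t i.
Proof.
by move=> ht z; have /has_ord[i iz] := all_ord ht z; exists i; rewrite inE.
Qed.

Lemma table_meet t :
  all (fun i => all (fun j => all (fun l =>
    has (fun x => all (mem (nth [::] t x)) [:: i; j; l]) (iota 0 10))
    (iota 0 4)) (iota 0 4)) (iota 0 4) ->
  forall i j l, exists x, [/\ x \in table_nonface t i,
    x \in table_nonface t j & x \in table_nonface t l].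
Proof.
move=> ht i j l.
have /has_ord[x /and4P[xi xj xl _]] := all_ord (all_ord (all_ord ht i) j) l.
by exists x; split; rewrite inE.
Qed.

Lemma table_disjoint t (i j l : 'I_4) :
  all (fun x => ~~ all (mem (nth [::] t x)) [:: (i : nat); (j : nat); (l : nat)])
    (iota 0 10) ->
  forall x, x \in table_nonface t i -> x \in table_nonface t j ->
    x \in table_nonface t l -> False.
Proof.
by move=> ht x; rewrite !inE => xi xj xl; have := all_ord ht x; rewrite /= xi xj xl.
Qed.

(** Lists of bits make the sixteen sets of nonfaces accessible to computation. *)
Definition set_of_bits (s : seq bool) : {set 'I_4} := [set i : 'I_4 | nth false s i]%SET.

Lemma set_of_bits_surj (S : {set 'I_4}) :
  exists a b c d, S = set_of_bits [:: a; b; c; d].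
Proof.
pose e i := @inord 3 i \in S.
exists (e 0%N), (e 1%N), (e 2%N), (e 3%N); apply/finset.setP => i; rewrite inE.
have -> : nth false [:: e 0%N; e 1%N; e 2%N; e 3%N] i = e i.
  by case: i => [[|[|[|[|]]]]].
by rewrite /e inord_val.
Qed.

Lemma card_set_of_bits s : #|set_of_bits s| = count (nth false s) (iota 0 4).
Proof. exact: card_set_ord. Qed.

Lemma card_union_table t (s : seq bool) : size s = 4%N ->
  #|union_nonfaces (table_nonface t) (set_of_bits s)| =
  count (fun x => has (nth false s) (nth [::] t x)) (iota 0 10).
Proof.
move=> s4; rewrite -card_set_ord; apply: eq_card => x; rewrite inE.
apply/finset.bigcupP/hasP => [[i si ix]|[i ix si]].
  by move: si ix; rewrite !inE => si ix; exists (i : nat).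
have i4 : (i < 4)%N by rewrite -s4 ltnNge; apply: contraL si => /(nth_default false) ->.
by exists (Ordinal i4); rewrite !inE.
Qed.

(* With one private vertex per nonface, unions of k nonfaces have 5, 8, 9, 10
   vertices for k = 1, 2, 3, 4, except that two of the pairwise unions have only
   seven: those of {2, 3} and {1, 3} for [table1], of {2, 3} and {0, 1} for
   [table2]. *)
Definition swap_pairs : {perm {set 'I_4}} :=
  tperm (set_of_bits [:: false; true; false; true])
        (set_of_bits [:: true; true; false; false]).

Lemma swap_pairsP (S : {set 'I_4}) :
  #|swap_pairs S| = #|S| /\
  #|union_nonfaces (table_nonface table2) (swap_pairs S)| =
  #|union_nonfaces (table_nonface table1) S|.
Proof.
rewrite /swap_pairs; case: tpermP => [->|->|/eqP neA /eqP neB].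
- by rewrite !card_set_of_bits !card_union_table.
- by rewrite !card_set_of_bits !card_union_table.
(* The sets fixed by the transposition are checked by evaluation, the two moved ones being excluded
   by [neA] and [neB]. *)
have [a [b [c [d S_bits]]]] := set_of_bits_surj S; split=> //.
rewrite S_bits !card_union_table //.
move: neA neB; rewrite {}S_bits.
by case: a; case: b; case: c; case: d => //=; rewrite eqxx.
Qed.

Theorem theorem2 (k : fieldType) (R : realType) :
  exists (m1 m2 : nat) (K1 : simplicial_complex m1) (K2 : simplicial_complex m2),
    [/\ forall i j : nat, betti k K1 i j = betti k K2 i j,
        dim_complex K1 = dim_complex K2,
        chromatic_number K1 = chromatic_number K2
      & buchstaber R K1 <> buchstaber R K2 /\
        real_buchstaber R K1 <> real_buchstaber R K2].
Proof.
exists 10%N, 10%N, (complex_of_nonfaces table1_neq0), (complex_of_nonfaces table2_neq0).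
pose v (x : nat) (x10 : (x < 10)%N) := Ordinal x10.
split.
- move=> l j; rewrite !betti_taylor.
  (* The bijection [swap_pairs] matches the families counted on the two sides. *)
  + rewrite -[RHS](card_preimset _ (@perm_inj _ swap_pairs)); apply: eq_card => S.
    by rewrite !inE; have [-> ->] := swap_pairsP S.
  + by apply: table_private; case=> [[|[|[|[|]]]]].
  + by apply: table_private; case=> [[|[|[|[|]]]]].
(* Vertices 4 and 6 meet all nonfaces of [table1], vertices 4 and 5 all those of [table2]. *)
- rewrite (@dim_complex_of_nonfaces _ _ _ _ (v 4 isT) (v 6 isT)) //.
  + rewrite (@dim_complex_of_nonfaces _ _ _ _ (v 4 isT) (v 5 isT)) //.
    * by case=> [[|[|[|[|]]]]] // p; rewrite !inE.
    * exact: table_nocommon.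
  + by case=> [[|[|[|[|]]]]] // p; rewrite !inE.
  + exact: table_nocommon.
- by rewrite !chromatic_number_complex_of_nonfaces //;
    [exact: card_table2 | exact: card_table1].
(* Each of the vertices 6 to 9 of [table2] lies in a different triple of nonfaces. *)
have meet2 := @table_meet table2 isT.
pose o (i : nat) (i4 : (i < 4)%N) := Ordinal i4.
(* In [table1] the nonfaces 0, 1 and 2 have no common vertex. Below, vertex 4, in nonfaces 0 and 1,
   serves as [xu], and vertex 1, in nonface 1 only, as [xt]. *)
have disj1 := @table_disjoint table1 (o 0 isT) (o 1 isT) (o 2 isT) isT.
have [le1 le1'] := (buchstaber_le1 R table2_neq0 meet2,
  real_buchstaber_le1 R table2_neq0 meet2).
split=> E; [move: le1; rewrite -E | move: le1'; rewrite -E];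
  rewrite leqNgt => /negP; apply.
  by apply: (@buchstaber_ge2 _ _ _ _ _ _ _ _ (v 4 isT) (v 1 isT) disj1); rewrite inE.
by apply: (@real_buchstaber_ge2 _ _ _ _ _ _ _ _ (v 4 isT) (v 1 isT) disj1); rewrite inE.
Qed.
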